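(* The witness verification problem is in PTIME. Here the problem takes as input a configuration $C=(G,G_s,V_T,M,0)$, consisting of a graph $G$, a subgraph $G_s$ of $G$, a set $V_T$ of test nodes of $G$, and the inference function $M$ of a fixed deterministic graph neural network, and decides whether $G_s$ is a factual witness for $V_T$, i.e. whether for every test node $v\in V_T$, $G_s$ is a factual witness of $M(v,G)=l$.
   Context: $G=(V,E)$ is a connected graph with a feature vector at every node. The inference function $M$ of a GNN-based node classifier is a polynomial-time computable function assigning to a test node $v$ and a graph a class label $M(v,G)=l$ from a finite label set. The GNN is fixed (all factors determining $M$ are fixed) and deterministic (same input gives same output). A subgraph $G_w$ of $G$ is a factual witness of $M(v,G)=l$ if $M(v,G_w)=l$ (in particular $v$ is a node of $G_w$). *)

(* Defs.v *)
(* MathComp world, with finmap for finite sets of node identifiers. *)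
From HB Require Import structures.
From mathcomp Require Import all_boot all_order all_algebra.
From mathcomp Require Import finmap.

Set Implicit Arguments.
Unset Strict Implicit.
Unset Printing Implicit Defensive.

Import Order.TTheory GRing.Theory Num.Theory.

(** * Deterministic multi-tape Turing machines and polynomial time *)

(* A two-way infinite tape, blank ([None]) outside the stored part.  The head
   scans the first cell of [right]; [left] lists the cells to the left of the
   head, nearest first. *)
Record tape (G : Type) := Tape { left : seq (option G); right : seq (option G) }.

Inductive move := MoveLeft | Stay | MoveRight.

Definition tape_read (G : Type) (t : tape G) : option G := head None (right t).

Definition tape_write (G : Type) (a : option G) (t : tape G) : tape G :=
  Tape (left t) (a :: behead (right t)).

Definition tape_move (G : Type) (m : move) (t : tape G) : tape G :=
  match m with
  | MoveLeft => Tape (behead (left t)) (head None (left t) :: right t)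
  | Stay => t
  | MoveRight => Tape (tape_read t :: left t) (behead (right t))
  end.

(* The tape alphabet consists of the input alphabet [S], the auxiliary symbols
   [tm_aux] and the blank. *)
Record machine (S : finType) := Machine {
  tm_tapes : nat;  (* the number of tapes minus one *)
  tm_state : finType;
  tm_aux : finType;
  tm_start : tm_state;
  tm_halt : pred tm_state;
  tm_delta : tm_state -> {ffun 'I_tm_tapes.+1 -> option (S + tm_aux)} ->
             tm_state * {ffun 'I_tm_tapes.+1 -> option (S + tm_aux) * move}
}.

Section MachineSemantics.
Variables (S : finType) (T : machine S).

Definition tm_symbol : finType := (S + tm_aux T)%type.

Record tm_config := TMConfig {
  cur_state : tm_state T;
  cur_tapes : {ffun 'I_(tm_tapes T).+1 -> tape tm_symbol}
}.

Definition tm_letter (s : S) : option tm_symbol := Some (inl s).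

(* The input is written on tape 0, to the right of the head. *)
Definition tm_init (x : seq S) : tm_config :=
  TMConfig (tm_start T)
    [ffun i => if i == ord0 then Tape [::] (map tm_letter x) else Tape [::] [::]].

(* A halted configuration no longer changes. *)
Definition tm_step (c : tm_config) : tm_config :=
  if tm_halt (cur_state c) then c else
  let qa := tm_delta (cur_state c) [ffun i => tape_read (cur_tapes c i)] in
  TMConfig qa.1
    [ffun i => tape_move (qa.2 i).2 (tape_write (qa.2 i).1 (cur_tapes c i))].

(* The output is the blank-free word starting at the head of tape 0. *)
Definition tm_output (c : tm_config) : seq (option tm_symbol) :=
  let w := right (cur_tapes c ord0) in take (index None w) w.

Definition tm_outputs_within (x y : seq S) (t : nat) : Prop :=
  let c := iter t tm_step (tm_init x) in
  tm_halt (cur_state c) /\ tm_output c = map tm_letter y.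

End MachineSemantics.

Definition poly_time_computable (S : finType) (A B : Type)
    (encA : A -> seq S) (encB : B -> seq S) (f : A -> B) : Prop :=
  exists (T : machine S) (p : {poly nat}), forall a : A,
    tm_outputs_within T (encA a) (encB (f a)) (p.[size (encA a)])%R.

(** * Encodings *)

(* Bits form binary numerals; the other symbols are delimiters. *)
Inductive sym := Bit of bool | Slash | Comma | NodeMark | EdgeMark | Sharp.

Definition sym_code (s : sym) : bool + 'I_5 :=
  match s with
  | Bit b => inl b
  | Slash => inr (inord 0)
  | Comma => inr (inord 1)
  | NodeMark => inr (inord 2)
  | EdgeMark => inr (inord 3)
  | Sharp => inr (inord 4)
  end.

Definition sym_decode (c : bool + 'I_5) : sym :=
  match c with
  | inl b => Bit b
  | inr i => nth Sharp [:: Slash; Comma; NodeMark; EdgeMark] i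
  end.

Lemma sym_codeK : cancel sym_code sym_decode.
Proof. by case=> [b|||||] //=; rewrite inordK. Qed.

HB.instance Definition _ := Finite.copy sym (can_type sym_codeK).

(* Decision problems are given by a type [A] of instances, an encoding of the
   instances and the property [P] of the yes-instances; the decider prints the
   truth value of [P]. *)
Definition enc_bool (b : bool) : seq sym := [:: Bit b].

Definition in_PTIME (A : Type) (enc : A -> seq sym) (P : A -> Prop) : Prop :=
  exists f : A -> bool,
    (forall a, f a <-> P a) /\ poly_time_computable enc enc_bool f.

(* Binary digits, least significant first; [0] has no digit. *)
Fixpoint bits_of_pos (p : BinNums.positive) : bitseq :=
  match p with
  | BinNums.xH => [:: true]
  | BinNums.xO q => false :: bits_of_pos q
  | BinNums.xI q => true :: bits_of_pos q
  end.

Definition bits (n : nat) : bitseq :=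
  if bin_of_nat n is BinNums.Npos p then bits_of_pos p else [::].

Definition enc_nat (n : nat) : seq sym := map Bit (bits n).

(* sign bit, then absolute value *)
Definition enc_int (z : int) : seq sym := Bit (z < 0)%R :: enc_nat `|z|%N.

Definition enc_rat (r : rat) : seq sym :=
  enc_int (numq r) ++ Slash :: enc_nat `|denq r|%N.

Definition enc_row (d : nat) (x : 'rV[rat]_d) : seq sym :=
  flatten [seq Comma :: enc_rat (x ord0 j) | j <- enum 'I_d].

Definition enc_label (L : finType) (l : L) : seq sym := enc_nat (enum_rank l).

(** * Graphs with node features *)

Local Open Scope fset_scope.

(* Finite simple undirected graphs, with natural numbers as node identifiers,
   so that a subgraph keeps the node names of the ambient graph.  An edge
   {u, v} is stored as both ordered pairs. *)
Record graph (d : nat) := Graph {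
  nodes : {fset nat};
  edges : {fset nat * nat};
  feat : {ffun nodes -> 'rV[rat]_d};
  edges_nodes : forall u v, (u, v) \in edges -> u \in nodes /\ v \in nodes;
  edges_sym : forall u v, (u, v) \in edges -> (v, u) \in edges;
  edges_irr : forall u, (u, u) \notin edges
}.

Definition adj (d : nat) (G : graph d) : rel (nodes G) :=
  fun u v => (val u, val v) \in edges G.

Definition connected (d : nat) (G : graph d) : Prop :=
  forall u v : nodes G, connect (@adj d G) u v.

Definition subgraph (d : nat) (H G : graph d) : Prop :=
  [/\ nodes H `<=` nodes G, edges H `<=` edges G
    & forall (u : nodes H) (v : nodes G), val u = val v -> feat H u = feat G v].

(* Adjacency lists: each node, in increasing order, with its identifier, its
   feature vector and its neighbours in increasing order. *)
Definition node_seq (d : nat) (G : graph d) : seq (nodes G) :=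
  sort (fun u v => val u <= val v) (enum {: nodes G}).

Definition enc_node (d : nat) (G : graph d) (v : nodes G) : seq sym :=
  NodeMark :: enc_nat (val v) ++ enc_row (feat G v) ++
  flatten [seq EdgeMark :: enc_nat (val u) | u <- node_seq G & adj v u].

Definition enc_graph (d : nat) (G : graph d) : seq sym :=
  flatten [seq enc_node v | v <- node_seq G].

(** * Node classifiers and witnesses *)

(* The inference function is defined on all graphs, connected or not, since it
   is also applied to subgraphs. *)
Definition classifier (d : nat) (L : finType) : Type :=
  forall G : graph d, nodes G -> L.

Definition enc_pointed (d : nat) (x : {G : graph d & nodes G}) : seq sym :=
  enc_nat (val (tagged x)) ++ enc_graph (tag x).

Definition poly_time_classifier (d : nat) (L : finType) (M : classifier d L) : Prop :=
  poly_time_computable (@enc_pointed d) (@enc_label L)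
    (fun x => M (tag x) (tagged x)).

(* [H] is a factual witness of the result [M(v, G) = l]. *)
Definition factual_witness (d : nat) (L : finType) (M : classifier d L)
    (G : graph d) (v : nodes G) (l : L) (H : graph d) : Prop :=
  [/\ subgraph H G, M G v = l
    & exists w : nodes H, val w = val v /\ M H w = l].

(* The variable part (G, G_s, V_T) of a configuration (G, G_s, V_T, M, 0). *)
Record witness_instance (d : nat) := WitnessInstance {
  wi_graph : graph d;
  wi_sub : graph d;
  wi_test : {fset nat};
  wi_connected : connected wi_graph;
  wi_subgraph : subgraph wi_sub wi_graph;
  wi_test_nodes : wi_test `<=` nodes wi_graph
}.

Definition enc_instance (d : nat) (C : witness_instance d) : seq sym :=
  enc_graph (wi_graph C) ++ Sharp :: enc_graph (wi_sub C) ++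
  Sharp :: flatten [seq Comma :: enc_nat v | v <- sort leq (enum_fset (wi_test C))].

Definition is_witness (d : nat) (L : finType) (M : classifier d L)
    (C : witness_instance d) : Prop :=
  forall v : nodes (wi_graph C), val v \in wi_test C ->
    factual_witness M v (M (wi_graph C) v) (wi_sub C).

(* Main.v *)
Require Import Defs.
From HB Require Import structures.
From mathcomp Require Import all_boot all_order all_algebra.
From mathcomp Require Import finmap zify.
From Stdlib Require Import FunctionalExtensionality.

(* The verifier splits its input into the words of [G] and [G_s] and the list of
   test nodes.  For each test node [v] it looks for the block of [v] in the word
   of [G_s], and rejects if there is none; this comes first because the machine
   computing [M] is only known to halt on well-formed pointed graphs.  Otherwise
   it simulates that machine on [(v, G)] and on [(v, G_s)] in parallel and
   compares the two results.  A clock records how far the simulated heads may have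
   wandered, so that their tapes can be erased before the next test node.
   The machine is obtained by compiling a structured program (sequence,
   conditional, loop) over tapes that are infinite streams, where trailing blanks
   do not matter and tapes can be compared by equality. *)

Set Implicit Arguments.
Unset Strict Implicit.
Unset Printing Implicit Defensive.

(** * Programs over stream tapes and their compilation *)

(** An instance already guarantees that $G_s$ is a subgraph of $G$, and the required label is the
    value of [M] on $G$ itself. So for each test node it remains to decide whether the node lies in
    $G_s$ and whether the two labels agree. Labels are not part of the input, which is why both
    values must be computed.

    The time is polynomial because the codes of $(v,G)$ and $(v,G_s)$ are shorter than the code of
    the instance, a polynomial over [nat] is monotone, and there are at most as many test nodes as
    input letters. Labels have bounded length since [L] is finite.

    The main obstacle is the reuse of the simulation tapes. An arbitrary machine may leave symbols
    separated by blanks anywhere near its heads, so no scan can detect where its tapes end. Only a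
    bound on the number of moves made does, and the clock supplies it. *)

Section StreamTapes.
Variable X : Type.
Implicit Types (s : nat -> option X) (t : (nat -> option X) * (nat -> option X)).

Definition stape : Type := ((nat -> option X) * (nat -> option X))%type.

Definition scons (a : option X) s : nat -> option X :=
  fun i => if i is i'.+1 then s i' else a.
Definition stail s : nat -> option X := fun i => s i.+1.
Definition blank : nat -> option X := fun _ => None.

Definition sread t : option X := t.2 0.
Definition swrite a t : stape := (t.1, scons a (stail t.2)).
Definition smove (m : move) t : stape :=
  match m with
  | MoveLeft => (stail t.1, scons (t.1 0) t.2)
  | Stay => t
  | MoveRight => (scons (t.2 0) t.1, stail t.2)
  end.

Definition stape_of (t : tape X) : stape :=
  (fun i => nth None (left t) i, fun i => nth None (right t) i).

Lemma scons_head s : scons (s 0) (stail s) = s.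
Proof. by apply: functional_extensionality => -[]. Qed.

Lemma scons_blank : scons None blank = blank.
Proof. by apply: functional_extensionality => -[]. Qed.

Lemma swrite_read t : swrite (sread t) t = t.
Proof. by rewrite /swrite scons_head; case: t. Qed.

Lemma stape_of_read (t : tape X) : sread (stape_of t) = tape_read t.
Proof. by case: t => l [|a r]. Qed.

Lemma stape_of_write a (t : tape X) :
  stape_of (tape_write a t) = swrite a (stape_of t).
Proof.
congr pair; apply: functional_extensionality => -[|i] //=.
by rewrite nth_behead.
Qed.

Lemma stape_of_move m (t : tape X) :
  stape_of (tape_move m t) = smove m (stape_of t).
Proof.
by case: m t => -[l r] //; congr pair; apply: functional_extensionality;
  case=> [|i] //=; rewrite ?nth_behead //; (case: l || case: r).
Qed.

End StreamTapes.
Arguments blank {X}.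

(** * Structured programs as finite control, and their semantics *)

Section Programs.
Variables (X : Type) (J : Type).

Definition tapes : Type := J -> stape X.
Definition reads : Type := J -> option X.
Definition actions : Type := J -> option X * move.

Definition read_all (c : tapes) : reads := fun j => sread (c j).
Definition act (a : actions) (c : tapes) : tapes :=
  fun j => smove (a j).2 (swrite (a j).1 (c j)).
Definition idle (r : reads) : actions := fun j => (r j, Stay).

Inductive prog :=
| Act of (reads -> actions)
| Seq of prog & prog
| If of (reads -> bool) & prog & prog
| While of (reads -> bool) & prog.

(** The state added by [option] evaluates the test of a conditional or loop. A sequence needs none:
    the last transition of its first part leads directly to the start of the second. *)
Fixpoint pstate (p : prog) : finType :=
  match p with
  | Act _ => unit
  | Seq p q => (pstate p + pstate q)%type
  | If _ p q => option (pstate p + pstate q)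
  | While _ p => option (pstate p)
  end.

Fixpoint pstart (p : prog) : pstate p :=
  match p with
  | Act _ => tt
  | Seq p q => inl (pstart p)
  | If _ p q => None
  | While _ p => None
  end.

(* The successor state [None] is the exit of the program. *)
Fixpoint pdelta (p : prog) : pstate p -> reads -> option (pstate p) * actions :=
  match p with
  | Act f => fun _ r => (None, f r)
  | Seq p q => fun s r =>
    match s with
    | inl s => let: (o, a) := pdelta s r in
      (Some (if o is Some s' then inl s' else inr (pstart q)), a)
    | inr s => let: (o, a) := pdelta s r in (omap inr o, a)
    end
  | If b p q => fun s r =>
    match s with
    | None => (Some (Some (if b r then inl (pstart p) else inr (pstart q))), idle r)
    | Some (inl s) => let: (o, a) := pdelta s r in (omap (Some \o inl) o, a)
    | Some (inr s) => let: (o, a) := pdelta s r in (omap (Some \o inr) o, a)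
    end
  | While b p => fun s r =>
    match s with
    | None => (if b r then Some (Some (pstart p)) else None, idle r)
    | Some s => let: (o, a) := pdelta s r in (Some o, a)
    end
  end.

(** A relation rather than a function, since a loop may run forever. *)
Inductive exits (p : prog) : pstate p -> tapes -> nat -> tapes -> Prop :=
| exits_last s c a : pdelta s (read_all c) = (None, a) -> exits s c 1 (act a c)
| exits_next s c s' a t c' : pdelta s (read_all c) = (Some s', a) ->
    exits s' (act a c) t c' -> exits s c t.+1 c'.

(** An upper bound on the time is enough, because a halted machine stays where it is. *)
Definition runs (p : prog) (c c' : tapes) (t : nat) : Prop :=
  exists2 t', t' <= t & exits (pstart p) c t' c'.

Lemma act_idle c : act (idle (read_all c)) c = c.
Proof.
by apply: functional_extensionality => j; rewrite /act /= swrite_read.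
Qed.

(** Serves all constructors at once: [h] places a part inside the whole program, and [o] is where
    control goes when the part exits, [None] meaning that the whole exits too. *)
Lemma exits_embed p p' (h : pstate p -> pstate p') (o : option (pstate p')) :
  (forall s r, pdelta (h s) r =
     (if (pdelta s r).1 is Some s' then Some (h s') else o, (pdelta s r).2)) ->
  forall s c t c', exits s c t c' ->
    if o is Some s2 then
      forall t2 c2, exits s2 c' t2 c2 -> exits (h s) c (t + t2) c2
    else exits (h s) c t c'.
Proof.
move=> hE s c t c'; elim=> {s c t c'} [s c a eq_s|s c s' a t c' eq_s _ IH].
  have := hE s (read_all c); rewrite eq_s /=.
  by case: (o) => [s2|] eq_h; [move=> t2 c2; apply: exits_next eq_h | apply: exits_last].
have := hE s (read_all c); rewrite eq_s /=.
case: (o) IH => [s2|] IH eq_h; last exact: exits_next eq_h IH.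
by move=> t2 c2 /IH; apply: exits_next eq_h.
Qed.

Lemma runs_le p c c' t t' : t <= t' -> runs p c c' t -> runs p c c' t'.
Proof. by move=> le_t [u le_u ?]; exists u => //; apply: leq_trans le_t. Qed.

Lemma runs_Act f c : runs (Act f) c (act (f (read_all c)) c) 1.
Proof. by exists 1 => //; apply: exits_last. Qed.

Lemma runs_Seq p q c1 c2 c3 t1 t2 :
  runs p c1 c2 t1 -> runs q c2 c3 t2 -> runs (Seq p q) c1 c3 (t1 + t2).
Proof.
move=> [u1 le1 ex1] [u2 le2 ex2]; exists (u1 + u2); first exact: leq_add.
apply: (@exits_embed p (Seq p q) inl (Some (inr (pstart q))) _ _ _ _ _ ex1).
  by move=> s r /=; case: pdelta => -[].
by apply: (@exits_embed q (Seq p q) inr None _ _ _ _ _ ex2) => s r /=; case: pdelta => -[].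
Qed.

Lemma runs_If (b : reads -> bool) p q c c' t :
  runs (if b (read_all c) then p else q) c c' t -> runs (If b p q) c c' t.+1.
Proof.
case=> u le_u; case: ifP => bc ex; exists u.+1 => //.
  apply: exits_next; first by rewrite /= bc.
  rewrite act_idle.
  by apply: (@exits_embed p (If b p q) (Some \o inl) None _ _ _ _ _ ex) => s r /=;
    case: pdelta => -[].
apply: exits_next; first by rewrite /= bc.
rewrite act_idle.
by apply: (@exits_embed q (If b p q) (Some \o inr) None _ _ _ _ _ ex) => s r /=;
  case: pdelta => -[].
Qed.

Lemma runs_While_exit (b : reads -> bool) p c : ~~ b (read_all c) -> runs (While b p) c c 1.
Proof.
move=> bc; exists 1 => //; rewrite -{2}(act_idle c).
by apply: exits_last; rewrite /= (negbTE bc).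
Qed.

Lemma runs_While_loop (b : reads -> bool) p c1 c2 c3 t1 t2 : b (read_all c1) ->
  runs p c1 c2 t1 -> runs (While b p) c2 c3 t2 ->
  runs (While b p) c1 c3 (t1 + t2).+1.
Proof.
move=> bc [u1 le1 ex1] [u2 le2 ex2]; exists (u1 + u2).+1; first by rewrite ltnS leq_add.
apply: exits_next; first by rewrite /= bc.
rewrite act_idle.
apply: (@exits_embed p (While b p) Some (Some None) _ _ _ _ _ ex1) => //.
by move=> s r /=; case: pdelta => -[].
Qed.

End Programs.

(** * Compilation to Turing machines *)

Section Compilation.
Variables (S aux J : finType) (p : prog (S + aux)%type (option J)).
Let X : Type := (S + aux)%type.

(** Machines take their input and give their output on tape [ord0], so this index is reserved for
    [None]. *)
Definition tape_index (j : option J) : 'I_#|J|.+1 :=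
  if j is Some j' then lift ord0 (enum_rank j') else ord0.
Definition index_tape (i : 'I_#|J|.+1) : option J := omap enum_val (unlift ord0 i).

Lemma tape_indexK : cancel tape_index index_tape.
Proof.
by case=> [j|]; rewrite /index_tape /= ?liftK ?unlift_none //= enum_rankK.
Qed.

Definition compile : machine S :=
  @Machine S #|J| (option (pstate p)) aux (Some (pstart p)) (fun s => s == None)
    (fun s r => if s is Some s then
       let: (o, a) := pdelta s (fun j => r (tape_index j)) in
       (o, [ffun i => a (index_tape i)])
     else (None, [ffun i => (r i, Stay)])).

Definition stapes_of (c : {ffun 'I_#|J|.+1 -> tape X}) : tapes X (option J) :=
  fun j => stape_of (c (tape_index j)).

(** A stream does not determine the list representing it, because of trailing blanks; hence the
    existential over [lc']. *)
Lemma compile_exits s c t c' : exits (p := p) s c t c' ->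
  forall lc, stapes_of lc = c -> exists2 lc', stapes_of lc' = c' &
    iter t (@tm_step S compile) (@TMConfig S compile (Some s) lc)
      = @TMConfig S compile None lc'.
Proof.
have step s0 (lc : {ffun 'I_#|J|.+1 -> tape X}) o a :
    pdelta s0 (read_all (stapes_of lc)) = (o, a) ->
  exists2 lc', stapes_of lc' = act a (stapes_of lc) &
    @tm_step S compile (@TMConfig S compile (Some s0) lc) = @TMConfig S compile o lc'.
  move=> eq_s; rewrite /tm_step /=.
  have -> : (fun j => [ffun i => tape_read (lc i)] (tape_index j)) = read_all (stapes_of lc).
    by apply: functional_extensionality => j; rewrite ffunE /read_all stape_of_read.
  rewrite eq_s /=; eexists; last by [].
  apply: functional_extensionality => j.
  by rewrite /stapes_of /act !ffunE tape_indexK stape_of_move stape_of_write.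
elim=> {s c t c'} [s c a eq_s|s c s' a t c' eq_s _ IH] lc lcE.
  by rewrite -lcE in eq_s *; exact: step eq_s.
move: eq_s IH; rewrite -lcE => /step[lc1 lc1E eq1] IH.
by rewrite iterSr eq1; apply: IH.
Qed.

Definition init_tapes (x : seq S) : tapes X (option J) :=
  fun j => if j is Some _ then (blank, blank)
           else (blank, fun i => nth None (map (Some \o inl) x) i).

(** The case [i = size y] demands the blank at which the output ends; cells further right are
    free. *)
Lemma compile_outputs x y c t : runs p (init_tapes x) c t ->
  (forall i, i <= size y -> (c None).2 i = nth None (map (Some \o inl) y) i) ->
  tm_outputs_within compile x y t.
Proof.
case=> u le_u /compile_exits/(_ (cur_tapes (tm_init compile x))) [].
  apply: functional_extensionality => -[j|]; rewrite /stapes_of /= ffunE //=;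
  congr pair; by apply: functional_extensionality => -[].
move=> lc' <- run_u out.
have {run_u} run_t : iter t (@tm_step S compile) (tm_init compile x)
    = @TMConfig S compile None lc'.
  by rewrite -(subnK le_u) iterD run_u iter_fix.
rewrite /tm_outputs_within run_t; split => //=.
rewrite /tm_output /=; set w := right _.
have {}out i : i <= size y -> nth None w i = nth None (map (@tm_letter _ compile) y) i.
  by move=> /out <-.
clear - out; elim: y w out => [|a y IH] [|b w] //= out.
- by have := out 0 isT => /= ->.
- by have := out 0 isT.
- by have /= -> := out 0 isT; rewrite /= IH // => i /(out i.+1).
Qed.

End Compilation.

(** * Words on tapes *)

Section Macros.
Variables (aux : Type) (J : eqType).
Let X : Type := (sym + aux)%type.
Implicit Types (c : tapes X J) (j : J) (t : stape X) (u w : seq sym).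

Definition scat w (s : nat -> option X) : nat -> option X :=
  foldr (fun a => scons (Some (inl a))) s w.

(* The word [w] from the head on, preceded by [u] read nearest cell first. *)
Definition zt u w : stape X := (scat u blank, scat w blank).

Fixpoint prints (y : seq sym) (s : nat -> option X) : Prop :=
  if y is a :: y' then s 0 = Some (inl a) /\ prints y' (stail s) else s 0 = None.

Lemma scat_cat u w s : scat (u ++ w) s = scat u (scat w s).
Proof. by rewrite /scat foldr_cat. Qed.

Lemma scat_rev_cons a w s : scat (rev (a :: w)) s = scat (rev w) (scons (Some (inl a)) s).
Proof. by rewrite rev_cons -cats1 scat_cat. Qed.

Lemma smove_leftK t : smove MoveRight (smove MoveLeft t) = t.
Proof. by case: t => l r; rewrite /smove /= scons_head. Qed.

Definition upd c j t : tapes X J := fun k => if k == j then t else c k.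

Lemma upd_same c j t : upd c j t j = t.
Proof. by rewrite /upd eqxx. Qed.

Lemma upd_other c j k t : k != j -> upd c j t k = c k.
Proof. by rewrite /upd => /negbTE ->. Qed.

Lemma upd_upd c j t t' : upd (upd c j t) j t' = upd c j t'.
Proof. by apply: functional_extensionality => k; rewrite /upd; case: eqP. Qed.

Lemma upd_id c j t : c j = t -> upd c j t = c.
Proof. by move=> <-; apply: functional_extensionality => k; rewrite /upd; case: eqP => [->|]. Qed.

Lemma upd_swap c j k t t' : j != k -> upd (upd c j t) k t' = upd (upd c k t') j t.
Proof.
move=> jk; apply: functional_extensionality => i; rewrite /upd.
by case: eqP => // ->; rewrite eq_sym (negbTE jk).
Qed.

Lemma runs_to (p : prog X J) c c1 c2 (t1 t2 : nat) :
  runs p c c1 t1 -> c1 = c2 -> t1 <= t2 -> runs p c c2 t2.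
Proof. by move=> r <- /runs_le; apply. Qed.

Definition isBit (o : option X) : bool := if o is Some (inl (Bit _)) then true else false.
Definition isBlank (o : option X) : bool := if o is None then true else false.
Definition isSym (a : sym) (o : option X) : bool :=
  if o is Some (inl b) then b == a else false.

Definition move_tape m j : prog X J :=
  Act (fun r k => if k == j then (r j, m) else (r k, Stay)).

Lemma runs_move_tape m j c : runs (move_tape m j) c (upd c j (smove m (c j))) 1.
Proof.
apply: runs_to (runs_Act _ _) _ _ => //; apply: functional_extensionality => k.
by rewrite /act /upd; case: eqP => [->|_] /=; rewrite swrite_read.
Qed.

Definition scan_right j : prog X J :=
  While (fun r => ~~ isBlank (r j)) (move_tape MoveRight j).

Lemma runs_scan_right j c u w : c j = zt u w ->
  runs (scan_right j) c (upd c j (zt (rev w ++ u) [::])) (2 * size w).+1.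
Proof.
elim: w u c => [|a w IH] u c cj.
  rewrite upd_id //; apply: runs_While_exit; by rewrite /read_all cj.
apply: runs_to (runs_While_loop _ (runs_move_tape _ _ _) (IH (a :: u) _ _)) _ _.
- by rewrite /read_all cj.
- by rewrite upd_same cj.
- by rewrite upd_upd rev_cons cat_rcons.
- by rewrite /=; lia.
Qed.

Definition scan_left j : prog X J :=
  While (fun r => ~~ isBlank (r j)) (move_tape MoveLeft j).

(** Moving left from [zt u w] puts the head on the nearest letter of [u], or on the blank before the
    word if [u] is empty. The scan therefore stops one cell before the word, which [rewind]
    corrects. *)
Lemma runs_scan_left j c u w : c j = smove MoveLeft (zt u w) ->
  runs (scan_left j) c (upd c j (smove MoveLeft (zt [::] (rev u ++ w)))) (2 * size u).+1.
Proof.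
elim: u w c => [|a u IH] w c cj.
  rewrite upd_id //; apply: runs_While_exit; by rewrite /read_all cj.
apply: runs_to (runs_While_loop _ (runs_move_tape _ _ _) (IH (a :: w) _ _)) _ _.
- by rewrite /read_all cj.
- by rewrite upd_same cj.
- by rewrite upd_upd rev_cons cat_rcons.
- by rewrite /=; lia.
Qed.

Definition rewind j : prog X J :=
  Seq (move_tape MoveLeft j) (Seq (scan_left j) (move_tape MoveRight j)).

Lemma runs_rewind j c u w : c j = zt u w ->
  runs (rewind j) c (upd c j (zt [::] (rev u ++ w))) (2 * size u + 3).
Proof.
move=> cj.
apply: runs_to (runs_Seq (runs_move_tape _ _ _)
  (runs_Seq (runs_scan_left (u := u) (w := w) _) (runs_move_tape _ _ _))) _ _.
- by rewrite upd_same cj.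
- by rewrite !upd_same !upd_upd smove_leftK.
- lia.
Qed.

Definition erase_right j : prog X J :=
  While (fun r => ~~ isBlank (r j))
    (Act (fun r k => if k == j then (None, MoveRight) else (r k, Stay))).

Lemma runs_erase_right j c w : c j = zt [::] w ->
  runs (erase_right j) c (upd c j (zt [::] [::])) (2 * size w).+1.
Proof.
elim: w c => [|a w IH] c cj.
  rewrite upd_id //; apply: runs_While_exit; by rewrite /read_all cj.
apply: runs_to (runs_While_loop _ (runs_Act _ _) (IH _ _)) _ _.
- by rewrite /read_all cj.
- by rewrite /act eqxx cj /= scons_blank.
- apply: functional_extensionality => k; rewrite /upd /act; case: eqP => //= _.
  by rewrite swrite_read.
- by rewrite /=; lia.
Qed.

Definition copy_right (b : option X -> bool) i j : prog X J :=
  While (fun r => b (r i))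
    (Act (fun r k => if (k == i) || (k == j) then (r i, MoveRight) else (r k, Stay))).

Lemma runs_copy_right b i j c l w s x : i != j ->
  all (fun a => b (Some (inl a))) w -> ~~ b (s 0) ->
  c i = (l, scat w s) -> c j = zt x [::] ->
  runs (copy_right b i j) c
    (upd (upd c i (scat (rev w) l, s)) j (zt (rev w ++ x) [::])) (2 * size w).+1.
Proof.
move=> ij bw bs; elim: w bw l x c => [_|a w IH /= /andP[ba bw]] l x c ci cj.
  by rewrite upd_id ?upd_id //; apply: runs_While_exit; rewrite /read_all ci.
apply: runs_to (runs_While_loop _ (runs_Act _ _)
  (IH bw (scons (Some (inl a)) l) (a :: x) _ _ _)) _ _.
- by rewrite /read_all ci.
- by rewrite /act eqxx /= /read_all ci.
- by rewrite /act /= [j == i]eq_sym (negbTE ij) eqxx /read_all ci cj.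
- rewrite scat_rev_cons rev_cons cat_rcons.
  apply: functional_extensionality => k; rewrite /upd /act.
  by case: eqP => // _; case: eqP => //= _; rewrite swrite_read.
- lia.
Qed.

Definition move_both i j : prog X J :=
  Act (fun r k => (r k, if (k == i) || (k == j) then MoveRight else Stay)).

Lemma runs_move_both i j c : i != j ->
  runs (move_both i j) c
    (upd (upd c i (smove MoveRight (c i))) j (smove MoveRight (c j))) 1.
Proof.
move=> ij; apply: runs_to (runs_Act _ _) _ _ => //.
apply: functional_extensionality => k; rewrite /act /upd swrite_read.
case: (eqVneq k j) => [->|_]; first by rewrite orbT.
by rewrite orbF; case: (eqVneq k i) => [->|].
Qed.

End Macros.

(** * Searching for the block of a node *)

Section Search.
Variables (aux : eqType) (J : eqType).
Let X : Type := (sym + aux)%type.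
Variables (i j : J).
Hypothesis ij : i != j.
Implicit Types (c : tapes X J).

Definition match_right : prog X J :=
  While (fun r => (r i == r j) && ~~ isBlank (r i)) (move_both aux i j).

Lemma isBit_map w (s : seq bool) : isBit (scat w (@blank X) 0) = false ->
  isBit (scat (map Bit s ++ w) (@blank X) 0) = (s != [::]).
Proof. by case: s. Qed.

(** [q] is the longest common prefix. Since [w] does not start with a bit, a numeral that is a
    proper prefix of the other is told apart from an equal one. *)
Lemma runs_match_right c p1 p2 (x b : bitseq) w :
  isBit (scat w (@blank X) 0) = false ->
  c i = zt aux p1 (map Bit x) -> c j = zt aux p2 (map Bit b ++ w) ->
  exists q x' b', [/\ x = q ++ x', b = q ++ b', (x' == [::]) && (b' == [::]) = (x == b) &
    runs match_right c (upd (upd c i (zt aux (rev (map Bit q) ++ p1) (map Bit x'))) j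
      (zt aux (rev (map Bit q) ++ p2) (map Bit b' ++ w))) (2 * size q).+1].
Proof.
move=> hw; elim: x b p1 p2 c => [|a x IH] b p1 p2 c ci cj.
  exists [::], [::], b; split=> //.
  rewrite upd_id ?upd_id //; apply: runs_While_exit.
  by rewrite /read_all ci cj /sread /= andbF.
have stop : (a :: x == b) = false -> ~~ (sread (c i) == sread (c j)) ->
    exists q x' b', [/\ a :: x = q ++ x', b = q ++ b',
      (x' == [::]) && (b' == [::]) = (a :: x == b) &
    runs match_right c (upd (upd c i (zt aux (rev (map Bit q) ++ p1) (map Bit x'))) j
      (zt aux (rev (map Bit q) ++ p2) (map Bit b' ++ w))) (2 * size q).+1].
  move=> ne neq; exists [::], (a :: x), b; split=> //.
  rewrite upd_id ?upd_id //; apply: runs_While_exit.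
  by rewrite /read_all (negbTE neq).
case: b cj stop => [|a' b] cj stop.
  apply: stop => //; rewrite ci cj /sread /=; apply/eqP => eq_w.
  by rewrite -eq_w in hw.
have [eq_a|ne_a] := eqVneq a a'; last first.
  apply: stop; first by rewrite eqseq_cons (negbTE ne_a).
  by rewrite ci cj /sread /=; apply: contra ne_a => /eqP[->].
subst a'; set c1 := upd (upd c i (smove MoveRight (c i))) j (smove MoveRight (c j)).
have c1i : c1 i = zt aux (Bit a :: p1) (map Bit x).
  by rewrite /c1 upd_other // upd_same ci.
have c1j : c1 j = zt aux (Bit a :: p2) (map Bit b ++ w).
  by rewrite /c1 upd_same cj.
have [q [x' [b' [-> -> e r]]]] := IH b _ _ _ c1i c1j.
exists (a :: q), x', b'; split=> //; first by rewrite e /= eqseq_cons eqxx.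
apply: runs_to (runs_While_loop _ (runs_move_both c ij) r) _ _.
- by rewrite /read_all ci cj /sread /= eqxx.
- rewrite /c1 [upd (upd _ j _) i _]upd_swap 1?eq_sym // !upd_upd.
  by rewrite /= !rev_cons !cat_rcons.
- by rewrite /=; lia.
Qed.

(* At the exit, the head of tape [i] is at the right end of its word if a block
   was found, and back at the left end otherwise. *)
Definition search : prog X J :=
  While (fun r => ~~ isBlank (r i) && ~~ isBlank (r j))
    (If (fun r => isSym NodeMark (r j))
       (Seq match_right
          (If (fun r => isBlank (r i) && ~~ isBit (r j))
             (Act (fun r => idle r)) (rewind aux i)))
       (move_tape aux MoveRight j)).

Definition block (b : bitseq * seq sym) : seq sym := NodeMark :: map Bit b.1 ++ b.2.

(** The first condition makes [NodeMark] a reliable sign of the start of a block, the second makes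
    the end of the identifier visible. *)
Definition block_wf (b : bitseq * seq sym) : bool :=
  (NodeMark \notin b.2) && ~~ isBit (scat b.2 (@blank X) 0).

(** [z] is the unread rest of a rejected block, which the induction has to carry. The head of tape
    [j] never goes back, and rewinding tape [i] costs at most a constant multiple of the letters of
    [j] just matched; so the total time is linear. *)
Lemma runs_search c x p z bs : all block_wf bs -> NodeMark \notin z ->
  c i = zt aux [::] (NodeMark :: map Bit x) ->
  c j = zt aux p (z ++ flatten (map block bs)) ->
  exists p' w', rev p' ++ w' = rev p ++ z ++ flatten (map block bs) /\
    runs search c (upd (upd c i (if x \in map fst bs
        then zt aux (rev (NodeMark :: map Bit x)) [::]
        else zt aux [::] (NodeMark :: map Bit x))) j (zt aux p' w'))
      (12 * size (z ++ flatten (map block bs))).+1.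
Proof.
elim: bs z p c => [|[b s] bs IHbs].
  move=> z p c _; elim: z p c => [|a z IH] p c nz ci cj.
    exists p, [::]; split=> //.
    rewrite upd_id ?upd_id //; apply: runs_While_exit.
    by rewrite /read_all ci cj /sread.
  move: nz; rewrite in_cons negb_or => /andP[na nz].
  have := IH (a :: p) (upd c j (smove MoveRight (c j))) nz.
  rewrite upd_same upd_other // cj => /(_ ci erefl)[p' [w' [e r]]].
  exists p', w'; split; first by rewrite e rev_cons cat_rcons.
  apply: runs_to (runs_While_loop _ (runs_If _) r) _ _.
  - by rewrite /read_all ci cj.
  - rewrite /read_all cj /isSym /sread /= eq_sym (negbTE na).
    by apply: runs_to (runs_move_tape _ _ _) _ (leqnn _); rewrite cj.
  - by rewrite [upd (upd c j _) i _]upd_swap 1?eq_sym // upd_upd.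
  - by rewrite /=; lia.
move=> z p c wf; elim: z p c => [|a z IH] p c nz ci cj; last first.
  move: nz; rewrite in_cons negb_or => /andP[na nz].
  have := IH (a :: p) (upd c j (smove MoveRight (c j))) nz.
  rewrite upd_same upd_other // cj => /(_ ci erefl)[p' [w' [e r]]].
  exists p', w'; split; first by rewrite e rev_cons cat_rcons.
  apply: runs_to (runs_While_loop _ (runs_If _) r) _ _.
  - by rewrite /read_all ci cj.
  - rewrite /read_all cj /isSym /sread /= eq_sym (negbTE na).
    by apply: runs_to (runs_move_tape _ _ _) _ (leqnn _); rewrite cj.
  - by rewrite [upd (upd c j _) i _]upd_swap 1?eq_sym // upd_upd.
  - by rewrite /=; lia.
case/andP: wf => /andP[ns bits_s] wf; rewrite /= in ns bits_s.
set W := s ++ flatten (map block bs).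
have hW : isBit (scat W (@blank X) 0) = false.
  by rewrite /W; case: (s) bits_s => [|a s'] //=; [case: (bs) | move/negbTE].
set c1 := upd (upd c i (smove MoveRight (c i))) j (smove MoveRight (c j)).
have c1i : c1 i = zt aux [:: NodeMark] (map Bit x).
  by rewrite /c1 upd_other // upd_same ci.
have c1j : c1 j = zt aux (NodeMark :: p) (map Bit b ++ W).
  by rewrite /c1 upd_same cj /= -catA.
have [q [x' [b' [eqx eqb eqxb r]]]] := runs_match_right hW c1i c1j.
(* One more iteration, in front of the matching of the numerals, passes the two [NodeMark]s. *)
have r1 : runs match_right c
    (upd (upd c i (zt aux (rev (map Bit q) ++ [:: NodeMark]) (map Bit x'))) j
      (zt aux (rev (map Bit q) ++ NodeMark :: p) (map Bit b' ++ W))) (2 * size q).+3.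
  apply: runs_to (runs_While_loop _ (runs_move_both c ij) r) _ _.
  - by rewrite /read_all ci cj /sread /= eqxx.
  - by rewrite /c1 [upd (upd _ j _) i _]upd_swap 1?eq_sym // upd_upd upd_upd.
  - by rewrite /=; clear; lia.
set c2 := upd _ j _ in r1.
have c2i : c2 i = zt aux (rev (map Bit q) ++ [:: NodeMark]) (map Bit x').
  by rewrite /c2 upd_other // upd_same.
have c2j : c2 j = zt aux (rev (map Bit q) ++ NodeMark :: p) (map Bit b' ++ W).
  by rewrite /c2 upd_same.
have test : isBlank (read_all c2 i) && ~~ isBit (read_all c2 j) = (x == b).
  rewrite -eqxb /read_all c2i c2j /sread /= isBit_map // negbK.
  by case: (x').
have sizeE : size (flatten (map block ((b, s) :: bs))) = (size b + size W).+1.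
  by rewrite /W /= !size_cat size_map; clear; lia.
have size_q : size b = size q + size b' by rewrite eqb size_cat.
have enter : ~~ isBlank (read_all c i) && ~~ isBlank (read_all c j) by rewrite /read_all ci cj.
have isN : isSym NodeMark (read_all c j) by rewrite /read_all cj /isSym /sread /= eqxx.
have -> : (x \in map fst ((b, s) :: bs)) = (x == b) || (x \in map fst bs) by [].
have [eq_xb|ne_xb] := eqVneq x b.
  have [x'0 b'0] : x' = [::] /\ b' = [::].
    by move: eqxb; rewrite eq_xb eqxx; case: (x'); case: (b').
  exists (rev (map Bit q) ++ NodeMark :: p), W; split.
    by rewrite /W /= rev_cat revK rev_cons eqb b'0 cats0 -cats1 -!catA.
  apply: (@runs_to _ _ _ _ c2 _ _ _ (runs_While_loop _ (runs_If _) (runs_While_exit _ _))).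
  - exact: enter.
  - rewrite isN; apply: (runs_Seq r1); apply: (@runs_If _ _ _ _ _ _ c2 1).
    by rewrite test eq_xb eqxx; apply: runs_to (runs_Act _ _) (act_idle _) _.
  - by rewrite /read_all c2i x'0.
  - by rewrite /c2 x'0 b'0 /= eqx x'0 cats0 rev_cons cats1.
  - by rewrite cat0s sizeE; move: size_q; clear; lia.
(* After a mismatch, the unmatched digits and the body of the block are skipped as the new [z]. *)
have nz' : NodeMark \notin map Bit b' ++ s.
  by rewrite mem_cat (negbTE ns) orbF; apply/mapP => -[].
have := IHbs (map Bit b' ++ s) (rev (map Bit q) ++ NodeMark :: p)
  (upd c2 i (zt aux [::] (NodeMark :: map Bit x))) wf nz'.
rewrite upd_same upd_other 1?eq_sym // c2j /W -catA => /(_ erefl erefl).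
case=> p' [w' [e r2]]; exists p', w'; split.
  rewrite e /= rev_cat revK rev_cons cat_rcons -!catA eqb map_cat.
  by rewrite -!catA.
apply: runs_to (runs_While_loop _ (runs_If _) r2) _ _.
- exact: enter.
- rewrite isN; apply: (runs_Seq r1); apply: (@runs_If _ _ _ _ _ c2 _ (2 * (size q).+1 + 3)).
  rewrite test (negbTE ne_xb).
  apply: runs_to (runs_rewind c2i) _ _.
    by rewrite eqx rev_cat revK map_cat.
  by rewrite size_cat size_rev size_map /=; clear; lia.
- rewrite upd_upd; apply: functional_extensionality => k.
  by rewrite /upd /c2 /upd; case: (k == j) => //; case: (k == i).
- rewrite cat0s sizeE; move: size_q; rewrite /W !size_cat size_map; clear; lia.
Qed.

End Search.

(** * The verifier *)

(* Apart from the input tape, [None : option work_tape], the verifier has a tape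
   [tV] for the current test node, a clock [tK], tapes [tG] and [tH] for the two
   graphs, and for each of the two simulated runs, on [G] ([false]) and on the
   subgraph ([true]), a cell [tS] holding the state and the tapes [tT]. *)
Inductive work_tape (n : nat) :=
  tV | tK | tG | tH | tS of bool | tT of bool & 'I_n.
Arguments tV {n}. Arguments tK {n}. Arguments tG {n}. Arguments tH {n}.
Arguments tS {n}. Arguments tT {n}.

Definition work_tape_code n (t : work_tape n) : bool * bool + (bool + bool * 'I_n) :=
  match t with
  | tV => inl (false, false) | tK => inl (false, true)
  | tG => inl (true, false) | tH => inl (true, true)
  | tS b => inr (inl b) | tT b i => inr (inr (b, i))
  end.

Definition work_tape_decode n (x : bool * bool + (bool + bool * 'I_n)) : work_tape n :=
  match x with
  | inl (false, false) => tV | inl (false, true) => tK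
  | inl (true, false) => tG | inl (true, true) => tH
  | inr (inl b) => tS b | inr (inr (b, i)) => tT b i
  end.

Lemma work_tape_codeK n : cancel (@work_tape_code n) (@work_tape_decode n).
Proof. by case. Qed.

HB.instance Definition _ n := Finite.copy (work_tape n) (can_type (@work_tape_codeK n)).

Section Verifier.
Variable T : machine sym.
Let N : nat := (tm_tapes T).+1.
(** Tests and actions of a program depend on scanned symbols only, so the states of [T] are made
    tape symbols, to be held by the cells [tS]. *)
Let aux : finType := (tm_aux T + tm_state T)%type.
Let X : finType := (sym + aux)%type.
Let J : finType := option (work_tape N).

Definition cfg (i v k g h : stape X) (s : bool -> stape X) (t : bool -> 'I_N -> stape X) :
    tapes X J :=
  fun j => match j with
  | None => i
  | Some tV => v | Some tK => k | Some tG => g | Some tH => h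
  | Some (tS b) => s b | Some (tT b l) => t b l
  end.

Section CfgUpd.
Variables (i v k g h x : stape X) (s : bool -> stape X) (t : bool -> 'I_N -> stape X).

Lemma upd_input : upd (cfg i v k g h s t) None x = cfg x v k g h s t.
Proof. by apply: functional_extensionality => -[[]|]. Qed.
Lemma upd_tV : upd (cfg i v k g h s t) (Some tV) x = cfg i x k g h s t.
Proof. by apply: functional_extensionality => -[[]|]. Qed.
Lemma upd_tK : upd (cfg i v k g h s t) (Some tK) x = cfg i v x g h s t.
Proof. by apply: functional_extensionality => -[[]|]. Qed.
Lemma upd_tG : upd (cfg i v k g h s t) (Some tG) x = cfg i v k x h s t.
Proof. by apply: functional_extensionality => -[[]|]. Qed.
Lemma upd_tH : upd (cfg i v k g h s t) (Some tH) x = cfg i v k g x s t.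
Proof. by apply: functional_extensionality => -[[]|]. Qed.
End CfgUpd.
Definition upd_cfg := (upd_input, upd_tV, upd_tK, upd_tG, upd_tH).

Definition no_tape : stape X := (blank, blank).
Definition clock (m : nat) : stape X := zt aux (nseq m Sharp) [::].
Definition tick : option X * move := (Some (inl Sharp), MoveRight).

Definition not_blank (o : option X) : bool := ~~ isBlank o.

(** The head waits on the blank before the word, where the next letter is to be prepended. *)
Definition loaded (y : bool -> seq sym) : bool -> 'I_N -> stape X :=
  fun b i => if i == ord0 then smove MoveLeft (zt aux [::] (y b)) else no_tape.

(* Copies leftwards, so that the target heads end at the left of the copies. *)
Definition load_left (src : J) (tg : pred bool) (cond : option X -> bool) : prog X J :=
  While (fun r => cond (r src))
    (Act (fun r k => if k == src then (r src, MoveLeft) else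
       match k with
       | Some tK => tick
       | Some (tT b i) => if tg b && (i == ord0) then (r src, MoveLeft) else (r k, Stay)
       | _ => (r k, Stay)
       end)).

Definition load_cfg (c : tapes X J) (src : J) (t : stape X) m y : tapes X J :=
  fun k => if k == src then t else
    match k with
    | Some tK => clock m
    | Some (tT b i) => loaded y b i
    | _ => c k
    end.

Lemma runs_load_left (src : J) (tg : pred bool) (cond : option X -> bool) c u s r m y :
  all (fun a => cond (Some (inl a))) u -> ~~ cond (s 0) ->
  runs (load_left src tg cond)
    (load_cfg c src (smove MoveLeft (scat u s, r)) m y)
    (load_cfg c src (smove MoveLeft (s, scat (rev u) r)) (size u + m)
       (fun b => if tg b then rev u ++ y b else y b))
    (2 * size u).+1.
Proof.
move=> + cs; elim: u r m y => [|a u IH] r m y /= => [_|/andP[ca cu]].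
  apply: runs_to (runs_While_exit _ _) _ _ => //.
  - by rewrite /read_all /load_cfg eqxx.
  - apply: functional_extensionality => k; rewrite /load_cfg; case: eqP => // _.
    by case: k => [[]|] // b i; rewrite /loaded; case: eqP => //; case: (tg b).
apply: runs_to (runs_While_loop _ (runs_to (runs_Act _ _) _ (leqnn _))
  (IH (scons (Some (inl a)) r) m.+1 (fun b => if tg b then a :: y b else y b) cu)) _ _.
- by rewrite /read_all /load_cfg eqxx.
- apply: functional_extensionality => k; rewrite /act /load_cfg /read_all !eqxx.
  case: (k == src) => //; case: k => [[| | | |b|b i]|] //=; rewrite ?swrite_read //.
  rewrite /loaded; case: (i == ord0); rewrite ?andbF ?andbT ?swrite_read //.
  by case: (tg b); rewrite ?swrite_read.
- apply: functional_extensionality => k; rewrite /load_cfg scat_rev_cons addnS.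
  case: (k == src) => //; case: k => [[| | | |b|b i]|] //=; rewrite /loaded.
  by case: (tg b); rewrite ?rev_cons ?cat_rcons.
- by rewrite mulnS.
Qed.

(** * Simulation of the classifier *)

Definition emb (o : option (tm_symbol T)) : option X :=
  omap (fun a => match a with inl a => inl a | inr a => inr (inl a) end) o.

Definition unemb (o : option X) : option (tm_symbol T) :=
  match o with
  | Some (inl a) => Some (inl a)
  | Some (inr (inl a)) => Some (inr a)
  | _ => None
  end.

Lemma embK : cancel emb unemb.
Proof. by case=> [[]|]. Qed.

Definition emb_tape (t : stape (tm_symbol T)) : stape X := (emb \o t.1, emb \o t.2).

Lemma emb_write a t : emb_tape (swrite a t) = swrite (emb a) (emb_tape t).
Proof. by congr pair; apply: functional_extensionality => -[]. Qed.

Lemma emb_move m t : emb_tape (smove m t) = smove m (emb_tape t).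
Proof. by case: m => //; congr pair; apply: functional_extensionality => -[]. Qed.

Definition state_tape (q : tm_state T) : stape X :=
  (blank, scons (Some (inr (inr q))) blank).

Definition run_tapes (tc : bool -> tm_config T) (b : bool) (l : 'I_N) : stape X :=
  emb_tape (stape_of (cur_tapes (tc b) l)).

Definition run_cfg i v m g h (tc : bool -> tm_config T) : tapes X J :=
  cfg i v (clock m) g h (fun b => state_tape (cur_state (tc b))) (run_tapes tc).

Definition running (o : option X) : bool :=
  if o is Some (inr (inr q)) then ~~ tm_halt q else false.

(** [new b] is [None] once run [b] has halted; its tapes then stay still while the other run
    continues, in accordance with [tm_step]. *)
Definition run_step (r : reads X J) : actions X J := fun k =>
  let new b := if r (Some (tS b)) is Some (inr (inr q)) then
      if tm_halt q then None
      else Some (tm_delta q [ffun l => unemb (r (Some (tT b l)))])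
    else None in
  match k with
  | Some tK => tick
  | Some (tS b) => (if new b is Some qa then Some (inr (inr qa.1)) else r k, Stay)
  | Some (tT b l) =>
      if new b is Some qa then (emb (qa.2 l).1, (qa.2 l).2) else (r k, Stay)
  | _ => (r k, Stay)
  end.

Lemma act_run_step i v m g h tc (c := run_cfg i v m g h tc) :
  act (run_step (read_all c)) c = run_cfg i v m.+1 g h (fun b => tm_step (tc b)).
Proof.
have rdE b : [ffun l => unemb (read_all c (Some (tT b l)))]
    = [ffun l => tape_read (cur_tapes (tc b) l)].
  apply/ffunP => l; rewrite !ffunE -stape_of_read.
  by rewrite /read_all /c /= /run_tapes /emb_tape /sread /= embK.
have sE b : read_all c (Some (tS b)) = Some (inr (inr (cur_state (tc b)))) by [].
have idleE k : swrite (read_all c k) (c k) = c k by exact: swrite_read.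
apply: functional_extensionality => -[[| | | |b|b l]|];
  rewrite /act /run_step ?idleE //.
- rewrite sE rdE /run_cfg /cfg /tm_step; by case: ifP.
- rewrite sE rdE /run_cfg /cfg /run_tapes /tm_step.
  case: ifP => _; first exact: idleE (Some (tT b l)).
  by rewrite ffunE stape_of_move stape_of_write emb_move emb_write.
Qed.

(* All non-blank cells are at distance at most [n] from the head; the scanned
   cell is number 0 of the right part. *)
Definition within (n : nat) (t : stape X) : Prop :=
  forall i, n <= i -> t.1 i = None /\ t.2 i.+1 = None.

Lemma within_le m n t : m <= n -> within m t -> within n t.
Proof. by move=> le_mn w i le_ni; apply: w; apply: leq_trans le_ni. Qed.

Lemma within_move n m t : within n t -> within n.+1 (smove m t).
Proof.
move=> w [|i] // lt_ni.
have [w1 w2] := w i lt_ni; have [w3 w4] := w i.+1 (leqW lt_ni).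
have [w5 w6] := w i.+2 (leqW (leqW lt_ni)).
by case: m.
Qed.

Lemma within_step n a m t : within n t -> within n.+1 (smove m (swrite a t)).
Proof. by move=> w; apply: within_move => i /w. Qed.

Lemma within_step_id n t : within n t -> within n.+1 t.
Proof. exact: within_le. Qed.

Definition simulate : prog X J :=
  While (fun r => running (r (Some (tS false))) || running (r (Some (tS true))))
    (Act run_step).

(** A step moves each head by at most one cell and adds one mark to the clock, so the clock still
    bounds the extent of every tape. The loop may end before [t] rounds, hence the inequality for
    [m']. *)
Lemma runs_simulate i v m g h tc t :
  (forall b, tm_halt (cur_state (iter t (@tm_step _ T) (tc b)))) ->
  (forall b l, within m (run_tapes tc b l)) ->
  exists m', [/\ m' <= t + m,
    forall b l, within m' (run_tapes (fun b => iter t (@tm_step _ T) (tc b)) b l) &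
    runs simulate (run_cfg i v m g h tc)
      (run_cfg i v m' g h (fun b => iter t (@tm_step _ T) (tc b))) (2 * t).+1].
Proof.
have halted (c : tm_config T) n : tm_halt (cur_state c) -> iter n (@tm_step _ T) c = c.
  by move=> hc; rewrite iter_fix // /tm_step hc.
elim: t m tc => [|t IH] m tc ht wm.
  exists m; split=> //; apply: runs_While_exit.
  rewrite /read_all /= !negb_or !negbK.
  by rewrite (ht false) (ht true).
case halt0: (tm_halt (cur_state (tc false)) && tm_halt (cur_state (tc true))).
  have tcE b : iter t.+1 (@tm_step _ T) (tc b) = tc b.
    by apply: halted; case: b; case/andP: halt0.
  have -> : (fun b => iter t.+1 (@tm_step _ T) (tc b)) = tc.
    by apply: functional_extensionality.
  exists m; split=> //; first by apply: leq_addl.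
  apply: runs_le (runs_While_exit _ _) => //.
  by rewrite /read_all /= negb_or !negbK.
have [||m' [le_m' w' r]] := IH m.+1 (fun b => tm_step (tc b)).
- by move=> b; rewrite -iterSr.
- move=> b l; have := wm b l; rewrite /run_tapes /tm_step.
  case: ifP => // _; first exact: within_step_id.
  move=> w; rewrite /= ffunE stape_of_move stape_of_write emb_move emb_write.
  exact: within_step.
have eqF : (fun b => iter t (@tm_step _ T) (tm_step (tc b)))
    = (fun b => iter t.+1 (@tm_step _ T) (tc b)).
  by apply: functional_extensionality => b; rewrite iterSr.
rewrite eqF in w' r; exists m'; split=> //; first by rewrite addSnnS.
apply: runs_to (runs_While_loop _ (runs_to (runs_Act _ _) (act_run_step _ _ _ _ _ _)
  (leqnn _)) r) _ _ => //; last by rewrite mulnS.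
by rewrite /read_all /= -negb_and halt0.
Qed.

(** * Comparison of the two results *)

Definition compare : prog X J :=
  let A b := Some (tT b ord0) in
  While (fun r => (r (A false) == r (A true)) && not_blank (r (A false)))
    (Act (fun r k => match k with
       | Some tK => tick
       | Some (tT b l) => (r k, if l == ord0 then MoveRight else Stay)
       | _ => (r k, Stay)
       end)).

(** The loop ends at the first difference or at a common blank, so the two symbols then scanned
    agree exactly when the words do. The heads move here too, hence the clock keeps counting. *)
Lemma runs_compare i v m g h s t y y' :
  prints y (t false ord0).2 -> prints y' (t true ord0).2 ->
  (forall b l, within m (t b l)) ->
  exists m' t', [/\ m' <= size y + m,
    forall b l, within m' (t' b l),
    (sread (t' false ord0) == sread (t' true ord0)) = (y == y') &
    runs compare (cfg i v (clock m) g h s t) (cfg i v (clock m') g h s t')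
      (2 * size y).+1].
Proof.
elim: y y' m t => [|a y IH] y' m t /= py py' wm.
  exists m, t; split=> //; last first.
    by apply: runs_While_exit; rewrite /read_all /= /sread py andbF.
  by rewrite /sread py; case: y' py' => [->|b y' /= [->]].
case: py => y0 py.
have stop : (a :: y == y') = false ->
    sread (t false ord0) != sread (t true ord0) ->
  exists m' t', [/\ m' <= size (a :: y) + m,
    forall b l, within m' (t' b l),
    (sread (t' false ord0) == sread (t' true ord0)) = (a :: y == y') &
    runs compare (cfg i v (clock m) g h s t) (cfg i v (clock m') g h s t')
      (2 * size (a :: y)).+1].
  move=> neq /negbTE ne; exists m, t; rewrite ne; split=> //; first exact: leq_addl.
  apply: runs_le (runs_While_exit _ _) => //.
  by rewrite /read_all /= ne.
case: y' py' stop => [|b y'] /= py' stop; first by apply: stop; rewrite // /sread y0 py'.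
case: py' => y'0 py'; have [eq_ab|ne_ab] := eqVneq a b; last first.
  apply: stop; first by rewrite eqseq_cons (negbTE ne_ab).
  by rewrite /sread y0 y'0; apply: contra ne_ab => /eqP[->].
subst b; pose t1 b l := if l == ord0 then smove MoveRight (t b l) else t b l.
have [|||m' [t' [le_m' w' e r]]] := IH y' m.+1 t1 => //.
  move=> b l; rewrite /t1; case: eqP => _; first exact: within_move.
  exact: within_step_id.
exists m', t'; split=> //; first by rewrite addSnnS.
  by rewrite e eqseq_cons eqxx.
apply: runs_to (runs_While_loop _ (runs_to (runs_Act _ _) _ (leqnn _)) r) _ _ => //.
- by rewrite /read_all /= /sread y0 y'0 eqxx.
- apply: functional_extensionality => -[[| | | |b|b l]|]; rewrite /act /read_all /= ?swrite_read //.
  by rewrite /t1; case: ifP.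
- by rewrite mulnS.
Qed.

(** * Cleaning and the main loop *)

(* If all non-blank cells are within [m] of the head, [m] moves to the right
   leave a blank right part, and then [2 m] erasing moves to the left, followed by
   one more erasure, clear the tape. *)
Definition wipe : prog X J :=
  Seq (move_tape aux MoveLeft (Some tK))
  (Seq (While (fun r => not_blank (r (Some tK)))
     (Act (fun r k => match k with
        | Some tK => (r k, MoveLeft)
        | Some (tT b l) => (r k, MoveRight)
        | _ => (r k, Stay)
        end)))
  (Seq (move_tape aux MoveRight (Some tK))
  (Seq (While (fun r => not_blank (r (Some tK)))
     (Seq
       (Act (fun r k => match k with
          | Some tK => (None, MoveRight)
          | Some (tT b l) => (None, MoveLeft)
          | _ => (r k, Stay)
          end))
       (Act (fun r k => if k is Some (tT b l) then (None, MoveLeft) else (r k, Stay)))))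
  (Act (fun r k => match k with
     | Some (tT _ _) | Some (tS _) => (None, Stay)
     | _ => (r k, Stay)
     end))))).

Definition erase_left (t : stape X) : stape X := smove MoveLeft (swrite None t).

Lemma iter_right n m t : within m t ->
  forall i, (n + m <= i -> (iter n (smove MoveRight) t).1 i = None) /\
            (m - n <= i -> (iter n (smove MoveRight) t).2 i.+1 = None).
Proof.
move=> w; elim: n => [|n IH] i; first by rewrite add0n subn0; split=> /w[].
rewrite iterS /=; split.
  case: i => [|i] // lt_i; exact: (IH i).1.
by move=> le_i; apply: (IH i.+1).2; move: le_i; clear; lia.
Qed.

Lemma iter_erase_left n m t : (forall i, m <= i -> t.1 i = None) ->
  (forall i, t.2 i.+1 = None) ->
  forall i, (m - n <= i -> (iter n erase_left t).1 i = None) /\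
            (iter n erase_left t).2 i.+1 = None.
Proof.
move=> w1 w2; elim: n => [|n IH] i; first by rewrite subn0; split=> [/w1|].
rewrite iterS /=; split.
  by move=> le_i; apply: (IH i.+1).1; move: le_i; clear; lia.
by case: i => [|i] //=; apply: (IH i).2.
Qed.

Lemma wiped m t : within m t ->
  swrite None (iter m.*2 erase_left (iter m (smove MoveRight) t)) = no_tape.
Proof.
move=> w; have w' := iter_right m w; set t1 := iter m _ t in w' *.
have e := @iter_erase_left m.*2 m.*2 t1.
have {}e i : (iter m.*2 erase_left t1).1 i = None /\ (iter m.*2 erase_left t1).2 i.+1 = None.
  have [||e1 e2] := e _ _ i.
  - by move=> j; rewrite -addnn => /(w' j).1.
  - by move=> j; apply: (w' j).2; rewrite subnn.
  - by split=> //; apply: e1; rewrite subnn.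
congr pair; apply: functional_extensionality => i; first by case: (e i).
by case: i => [|i] //; case: (e i).
Qed.

(** The clock is used twice: walking back over its marks counts the [m] moves to the right, and
    erasing them from left to right pays for two erasing moves per mark, [2 m] in all. *)
Lemma runs_wipe i v m g h s t :
  (forall b, exists x, s b = (blank, scons x blank)) ->
  (forall b l, within m (t b l)) ->
  runs wipe (cfg i v (clock m) g h s t)
    (cfg i v no_tape g h (fun=> no_tape) (fun _ _ => no_tape)) (5 * m + 5).
Proof.
move=> sE wt.
have loop1 u w t0 :
  runs (While (fun r : reads X J => not_blank (r (Some tK)))
     (Act (fun r k => match k with
        | Some tK => (r k, MoveLeft)
        | Some (tT b l) => (r k, MoveRight)
        | _ => (r k, Stay)
        end)))
    (cfg i v (smove MoveLeft (zt aux u w)) g h s t0)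
    (cfg i v (smove MoveLeft (zt aux [::] (rev u ++ w))) g h s
       (fun b l => iter (size u) (smove MoveRight) (t0 b l))) (2 * size u).+1.
  elim: u w t0 => [|a u IH] w t0; first by apply: runs_While_exit.
  apply: runs_to (runs_While_loop _ (runs_to (runs_Act _ _) _ (leqnn _))
    (IH (a :: w) (fun b l => smove MoveRight (t0 b l)))) _ _ => //.
  - by apply: functional_extensionality => -[[| | | |b|b l]|];
      rewrite /act /read_all /= ?swrite_read.
  - rewrite rev_cons cat_rcons; congr cfg.
    by do 2!apply: functional_extensionality => ?; rewrite -iterSr.
  - by rewrite mulnS.
have loop2 w t0 :
  runs (While (fun r : reads X J => not_blank (r (Some tK)))
     (Seq
       (Act (fun r k => match k with
          | Some tK => (None, MoveRight)
          | Some (tT b l) => (None, MoveLeft)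
          | _ => (r k, Stay)
          end))
       (Act (fun r k => if k is Some (tT b l) then (None, MoveLeft) else (r k, Stay)))))
    (cfg i v (zt aux [::] w) g h s t0)
    (cfg i v no_tape g h s
       (fun b l => iter (size w).*2 erase_left (t0 b l))) (3 * size w).+1.
  elim: w t0 => [|a w IH] t0; first by apply: runs_While_exit.
  apply: runs_to (runs_While_loop _ (runs_to (runs_Seq (runs_Act _ _) (runs_Act _ _))
    _ (leqnn _)) (IH (fun b l => erase_left (erase_left (t0 b l))))) _ _ => //.
  - apply: functional_extensionality => -[[| | | |b|b l]|];
      rewrite /act /read_all /= ?swrite_read //= scons_blank.
    exact: (swrite_read (blank, _)).
  - congr cfg.
    by do 2!apply: functional_extensionality => ?; rewrite doubleS -!iterSr.
  - by rewrite mulnS.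
set c0 := cfg i v (clock m) g h s t.
have r1 := runs_move_tape MoveLeft (Some tK) c0.
rewrite {2}/c0 upd_cfg in r1.
have r2 := loop1 (nseq m Sharp) [::] t.
pose t1 b l := iter (size (nseq m Sharp)) (smove MoveRight) (t b l).
have r3 : runs (move_tape aux MoveRight (Some tK))
    (cfg i v (smove MoveLeft (zt aux [::] (rev (nseq m Sharp) ++ [::]))) g h s t1)
    (cfg i v (zt aux [::] (rev (nseq m Sharp) ++ [::])) g h s t1) 1.
  apply: runs_to (runs_move_tape _ _ _) _ _ => //.
  by rewrite upd_cfg; congr cfg; apply: smove_leftK.
have r4 := loop2 (rev (nseq m Sharp) ++ [::])
  (fun b l => iter (size (nseq m Sharp)) (smove MoveRight) (t b l)).
apply: runs_to (runs_Seq r1 (runs_Seq r2 (runs_Seq r3 (runs_Seq r4 (runs_Act _ _))))) _ _.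
  apply: functional_extensionality => -[[| | | |b|b l]|];
    rewrite /act /read_all /= ?swrite_read //.
  - exact: (swrite_read no_tape).
  - by have [x ->] := sE b; congr pair; apply: scons_blank.
  - by rewrite cats0 size_rev size_nseq wiped.
by rewrite cats0 size_rev size_nseq; clear; lia.
Qed.

(** * Loading and starting the two runs *)

Lemma load_cfg_tG i v k g h s t x m y :
  load_cfg (cfg i v k g h s t) (Some tG) x m y = cfg i v (clock m) x h s (loaded y).
Proof. by apply: functional_extensionality => -[[]|]. Qed.

Lemma load_cfg_tH i v k g h s t x m y :
  load_cfg (cfg i v k g h s t) (Some tH) x m y = cfg i v (clock m) g x s (loaded y).
Proof. by apply: functional_extensionality => -[[]|]. Qed.

Lemma load_cfg_tV i v k g h s t x m y :
  load_cfg (cfg i v k g h s t) (Some tV) x m y = cfg i x (clock m) g h s (loaded y).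
Proof. by apply: functional_extensionality => -[[]|]. Qed.

Lemma load_cfg_src c src t m y : load_cfg c src t m y src = t.
Proof. by rewrite /load_cfg eqxx. Qed.

Lemma upd_load_cfg c src t t' m y :
  upd (load_cfg c src t m y) src t' = load_cfg c src t' m y.
Proof.
by apply: functional_extensionality => k; rewrite /upd /load_cfg; case: eqP.
Qed.

(** The final scan brings the source head back to the right end, ready for the next test node. *)
Definition load_word (src : J) (tg : pred bool) : prog X J :=
  Seq (move_tape aux MoveLeft src) (Seq (load_left src tg not_blank)
    (Seq (move_tape aux MoveRight src) (scan_right aux src))).

Lemma runs_load_word c src tg w m y (t := zt aux (rev w) [::]) :
  runs (load_word src tg) (load_cfg c src t m y)
    (load_cfg c src t (size w + m) (fun b => if tg b then w ++ y b else y b))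
    (4 * size w + 4).
Proof.
have r1 := runs_move_tape MoveLeft src (load_cfg c src t m y).
rewrite upd_load_cfg load_cfg_src in r1.
have nb : all (fun a => not_blank (Some (inl a))) (rev w) by apply/allP.
have r2 := @runs_load_left src tg not_blank c (rev w) blank blank m y nb isT.
rewrite size_rev revK in r2.
set y' := fun b => _ in r2 *.
have r3 := runs_move_tape MoveRight src
  (load_cfg c src (smove MoveLeft (blank, scat w blank)) (size w + m) y').
rewrite upd_load_cfg load_cfg_src smove_leftK in r3.
have r4 := @runs_scan_right _ _ src (load_cfg c src (zt aux [::] w) (size w + m) y') [::] w
  (load_cfg_src _ _ _ _ _).
rewrite upd_load_cfg cats0 in r4.
apply: runs_to (runs_Seq r1 (runs_Seq r2 (runs_Seq r3 r4))) _ _ => //.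
by move: (size w) => n; clear; lia.
Qed.

(** Copying stops at the leading [NodeMark], which is not a bit. Both runs receive the identifier,
    whose tape can then be erased. *)
Definition load_node : prog X J :=
  Seq (move_tape aux MoveLeft (Some tV))
    (Seq (load_left (Some tV) xpredT (@isBit aux)) (erase_right aux (Some tV))).

Lemma runs_load_node c x m y :
  runs load_node
    (load_cfg c (Some tV) (zt aux (rev (NodeMark :: map Bit x)) [::]) m y)
    (load_cfg c (Some tV) no_tape (size x + m) (fun b => map Bit x ++ y b))
    (4 * size x + 5).
Proof.
set w := map Bit x.
have r1 := runs_move_tape MoveLeft (Some tV)
  (load_cfg c (Some tV) (zt aux (rev (NodeMark :: w)) [::]) m y).
rewrite upd_load_cfg load_cfg_src in r1.
have nb : all (fun a => isBit (Some (inl a : X))) (rev w).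
  by apply/allP => a; rewrite mem_rev => /mapP[b _ ->].
have r2 : runs (load_left (Some tV) xpredT (@isBit aux))
    (load_cfg c (Some tV) (smove MoveLeft (zt aux (rev (NodeMark :: w)) [::])) m y)
    (load_cfg c (Some tV) (zt aux [::] (NodeMark :: w)) (size x + m) (fun b => w ++ y b))
    (2 * size x).+1.
  have := @runs_load_left (Some tV) xpredT (@isBit aux) c (rev w)
    (scons (Some (inl NodeMark)) blank) blank m y nb isT.
  by rewrite size_rev size_map revK /zt scat_rev_cons.
have r3 := @runs_erase_right _ _ (Some tV) (load_cfg c (Some tV)
  (zt aux [::] (NodeMark :: w)) (size x + m) (fun b => w ++ y b)) (NodeMark :: w)
  (load_cfg_src _ _ _ _ _).
rewrite upd_load_cfg in r3.
apply: runs_to (runs_Seq r1 (runs_Seq r2 r3)) _ _ => //.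
by rewrite /= size_map; move: (size x) => n; clear; lia.
Qed.

Definition start_runs : prog X J :=
  Act (fun r k => match k with
    | Some (tS b) => (Some (inr (inr (tm_start T))), Stay)
    | Some (tT b l) => (r k, if l == ord0 then MoveRight else Stay)
    | _ => (r k, Stay)
    end).

Lemma emb_word w : emb \o (fun i => nth None (map (@tm_letter _ T) w) i) = scat w blank.
Proof.
apply: functional_extensionality => i.
by elim: w i => [|a w IH] [|i] //=; apply: IH.
Qed.

Lemma runs_start_runs i v m g h (y : bool -> seq sym) :
  runs start_runs (cfg i v (clock m) g h (fun=> no_tape) (loaded y))
    (run_cfg i v m g h (fun b => tm_init T (y b))) 1.
Proof.
apply: runs_to (runs_Act _ _) _ _ => //.
apply: functional_extensionality => -[[| | | |b|b l]|];
  rewrite /act /read_all ?swrite_read //.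
transitivity (smove (if l == ord0 then MoveRight else Stay) (loaded y b l)).
  by congr smove; apply: swrite_read.
rewrite /loaded /run_cfg [RHS]/= /run_tapes /= ffunE.
case: (eqVneq l ord0) => _.
  transitivity (zt aux [::] (y b)); first exact: (smove_leftK (zt aux [::] (y b))).
  by rewrite /emb_tape /= emb_word (emb_word [::]).
by rewrite /emb_tape /= (emb_word [::]).
Qed.

Lemma prints_output (c : tm_config T) y : tm_output c = map (@tm_letter _ T) y ->
  prints y (emb_tape (stape_of (cur_tapes c ord0))).2.
Proof.
rewrite /tm_output /=; elim: y (right _) => [|a y IH] [|[b|] w] //= [-> /IH p].
by split.
Qed.

(* [print_bit false] also makes the main loop stop, as that loop only continues
   on [Comma]. *)
Definition print_bit (b : bool) : prog X J :=
  Seq (move_tape aux MoveRight None)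
  (Seq (Act (fun r k => if k is None then (None, MoveLeft) else (r k, Stay)))
       (Act (fun r k => if k is None then (Some (inl (Bit b)), Stay) else (r k, Stay)))).

(** The next cell is blanked first, so the output has length one whatever input is left there. *)
Lemma runs_print_bit b c :
  exists2 c', runs (print_bit b) c c' 3 & prints [:: Bit b] (c' None).2.
Proof.
eexists; first exact: runs_Seq (runs_move_tape _ _ _) (runs_Seq (runs_Act _ _) (runs_Act _ _)).
by split.
Qed.

(** Each load puts its word in front, so the graphs are loaded before the identifier that begins the
    code of a pointed graph. *)
Definition test_runs : prog X J :=
  Seq (load_word (Some tG) negb) (Seq (load_word (Some tH) id) (Seq load_node
  (Seq start_runs (Seq simulate (Seq compare
  (If (fun r => r (Some (tT false ord0)) == r (Some (tT true ord0)))
     wipe (print_bit false))))))).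

Lemma runs_test_runs i g h x (y : bool -> seq sym) t n
    (gt := zt aux (rev g) [::]) (ht := zt aux (rev h) [::]) :
  (forall b, tm_outputs_within T (map Bit x ++ if b then h else g) (y b) t) ->
  size (y false) <= n ->
  exists2 c', runs test_runs
      (cfg i (zt aux (rev (NodeMark :: map Bit x)) [::]) no_tape gt ht
         (fun=> no_tape) (fun _ _ => no_tape)) c'
      (30 * (size g + size h + size x + t + n + 1)) &
    if y false == y true
    then c' = cfg i no_tape no_tape gt ht (fun=> no_tape) (fun _ _ => no_tape)
    else prints [:: Bit false] (c' None).2.
Proof.
move=> out size_y; set v := zt aux _ [::].
(* Blank tapes are the state with nothing loaded and the clock at 0, since moving left on a blank
   stream changes nothing. *)
have -> : cfg i v no_tape gt ht (fun=> no_tape) (fun _ _ => no_tape)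
    = load_cfg (cfg i v no_tape gt ht (fun=> no_tape) (fun _ _ => no_tape))
        (Some tG) gt 0 (fun=> [::]).
  rewrite load_cfg_tG; congr cfg.
  do 2!apply: functional_extensionality => ?; rewrite /loaded; case: ifP => // _.
  by congr pair; rewrite /= scons_blank.
set c0 := cfg _ _ _ _ _ _ _.
pose y1 b := if ~~ b then g ++ [::] else [::].
pose y2 b := if b then h ++ y1 b else y1 b.
have r1 : runs (load_word (Some tG) negb) (load_cfg c0 (Some tG) gt 0 (fun=> [::]))
    (load_cfg c0 (Some tH) ht (size g + 0) y1) (4 * size g + 4).
  apply: runs_to (runs_load_word _ _ _ _ _ _) _ (leqnn _).
  by rewrite load_cfg_tG load_cfg_tH.
have r2 : runs (load_word (Some tH) id) (load_cfg c0 (Some tH) ht (size g + 0) y1)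
    (load_cfg c0 (Some tV) v (size h + (size g + 0)) y2) (4 * size h + 4).
  apply: runs_to (runs_load_word _ _ _ _ _ _) _ (leqnn _).
  by rewrite load_cfg_tH load_cfg_tV.
have r3 := runs_load_node c0 x (size h + (size g + 0)) y2.
set m := size x + _ in r3.
have r4 := runs_start_runs i no_tape m gt ht (fun b => map Bit x ++ if b then h else g).
have [||m1 [le_m1 w1 r5]] := @runs_simulate i no_tape m gt ht
  (fun b => tm_init T (map Bit x ++ if b then h else g)) t.
- by move=> b; have [] := out b.
(* Loading left the clock at [m], the total length of the node and both graphs, which bounds each
   input word. *)
- move=> b l j le_j; rewrite /run_tapes /= ffunE.
  have big : size (map Bit x ++ if b then h else g) <= j.+1.
    apply: leq_trans (leqW le_j); rewrite /m size_cat size_map.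
    by case: (b); clear; lia.
  by case: ifP => _; rewrite /= !nth_default //= size_map.
have [||m2 [t' [le_m2 w2 e r6]]] := @runs_compare i no_tape m1 gt ht
  (fun b => state_tape (cur_state (iter t (@tm_step _ T)
     (tm_init T (map Bit x ++ if b then h else g))))) _ (y false) (y true) _ _ w1.
- by apply: prints_output; have [] := out false.
- by apply: prints_output; have [] := out true.
set c6 := cfg _ _ _ _ _ _ t' in r6.
have [c' r7 post] : exists2 c', runs
    (If (fun r : reads X J => r (Some (tT false ord0)) == r (Some (tT true ord0)))
     wipe (print_bit false)) c6 c' (5 * m2 + 5).+1 &
  if y false == y true
    then c' = cfg i no_tape no_tape gt ht (fun=> no_tape) (fun _ _ => no_tape)
    else prints [:: Bit false] (c' None).2.
  rewrite -e; case eq_read: (sread (t' false ord0) == sread (t' true ord0)).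
    eexists; last by [].
    apply: runs_If.
    rewrite -[X in if X then _ else _]/(sread (t' false ord0) == sread (t' true ord0))
      eq_read.
    by apply: runs_wipe => // b; eexists.
  have [c' r post] := runs_print_bit false c6; exists c' => //.
  apply: runs_If.
  rewrite -[X in if X then _ else _]/(sread (t' false ord0) == sread (t' true ord0))
    eq_read.
  by apply: runs_le r; clear; lia.
exists c' => //.
apply: runs_to (runs_Seq r1 (runs_Seq r2 (runs_Seq (runs_to r3 _ (leqnn _)) (runs_Seq r4
  (runs_Seq r5 (runs_Seq r6 r7)))))) _ _ => //.
  rewrite load_cfg_tV; congr cfg; congr loaded.
  by apply: functional_extensionality => -[]; rewrite /y2 /y1 /= ?cats0.
by move: le_m1 le_m2 size_y; rewrite /m; clear; lia.
Qed.

(** The identifier is stored behind a [NodeMark] so that it has the shape of the start of a block.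
    After the search, a blank under the head of [tV] means that the node was found. *)
Definition check_node : prog X J :=
  Seq (Act (fun r k => match k with
    | None => (r k, MoveRight)
    | Some tV => (Some (inl NodeMark), MoveRight)
    | _ => (r k, Stay)
    end))
  (Seq (copy_right (@isBit aux) None (Some tV))
  (Seq (rewind aux (Some tV))
  (Seq (rewind aux (Some tH))
  (Seq (search aux (Some tV) (Some tH))
  (If (fun r => isBlank (r (Some tV)))
     (Seq (scan_right aux (Some tH)) test_runs)
     (print_bit false)))))).

Definition loop_cfg (g h u w : seq sym) : tapes X J :=
  cfg (zt aux u w) no_tape no_tape (zt aux (rev g) [::]) (zt aux (rev h) [::])
    (fun=> no_tape) (fun _ _ => no_tape).

(** After a rejection the verdict is final, so nothing is cleaned and only the printed bit is
    specified. *)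
Lemma runs_check_node g bs u x w (y : bool -> seq sym) t n
    (h := flatten (map block bs)) :
  all (block_wf aux) bs -> ~~ isBit (scat w (@blank X) 0) ->
  (x \in map fst bs ->
     forall b, tm_outputs_within T (map Bit x ++ if b then h else g) (y b) t) ->
  size (y false) <= n ->
  exists2 c', runs check_node (loop_cfg g h u (Comma :: map Bit x ++ w)) c'
      (60 * (size g + size h + size x + t + n + 1)) &
    if (x \in map fst bs) && (y false == y true)
    then c' = loop_cfg g h (rev (Comma :: map Bit x) ++ u) w
    else prints [:: Bit false] (c' None).2.
Proof.
move=> wf bw out size_y; set bx := map Bit x.
set gt := zt aux (rev g) [::]; set ht := zt aux (rev h) [::].
pose c i v q := cfg i v no_tape gt q (fun=> no_tape) (fun _ _ => no_tape).
set iw := zt aux (rev (Comma :: bx) ++ u) w.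
have r1 : runs (Act (fun r : reads X J => fun k : J => match k with
    | None => (r k, MoveRight)
    | Some tV => (Some (inl NodeMark), MoveRight)
    | _ => (r k, Stay)
    end)) (loop_cfg g h u (Comma :: bx ++ w))
    (c (zt aux (Comma :: u) (bx ++ w)) (zt aux [:: NodeMark] [::]) ht) 1.
  apply: runs_to (runs_Act _ _) _ _ => //.
  by apply: functional_extensionality => -[[| | | |b|b l]|];
    rewrite /act /read_all ?swrite_read.
have r2 : runs (copy_right (@isBit aux) None (Some tV))
    (c (zt aux (Comma :: u) (bx ++ w)) (zt aux [:: NodeMark] [::]) ht)
    (c iw (zt aux (rev (NodeMark :: bx)) [::]) ht) (2 * size x).+1.
  apply: runs_to (runs_copy_right (l := scat (Comma :: u) blank) (w := bx)
    (s := scat w blank) (x := [:: NodeMark]) _ _ bw _ _) _ _ => //.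
  - by apply/allP => a /mapP[b _ ->].
  - by rewrite /c /zt scat_cat.
  - by rewrite /c upd_input upd_tV /iw !rev_cons !cats1 cat_rcons /zt scat_cat.
  - by rewrite size_map.
have r3 : runs (rewind aux (Some tV)) (c iw (zt aux (rev (NodeMark :: bx)) [::]) ht)
    (c iw (zt aux [::] (NodeMark :: bx)) ht) (2 * (size x).+1 + 3).
  apply: runs_to (runs_rewind (u := rev (NodeMark :: bx)) (w := [::]) _) _ _ => //.
  - by rewrite revK cats0 /c upd_tV.
  - by rewrite size_rev /= size_map.
have r4 : runs (rewind aux (Some tH)) (c iw (zt aux [::] (NodeMark :: bx)) ht)
    (c iw (zt aux [::] (NodeMark :: bx)) (zt aux [::] h)) (2 * size h + 3).
  apply: runs_to (runs_rewind (u := rev h) (w := [::]) _) _ _ => //.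
  - by rewrite revK cats0 /c upd_tH.
  - by rewrite size_rev.
have [p' [w' [eq_h r5]]] := @runs_search aux J (Some tV) (Some tH) isT
  (c iw (zt aux [::] (NodeMark :: bx)) (zt aux [::] h)) x [::] [::] bs wf isT erefl erefl.
rewrite /c upd_tV upd_tH -/(c _ _ _) cat0s -/h in eq_h r5.
set v5 := if _ then _ else _ in r5.
have [c' r6 post] : exists2 c', runs (If (fun r : reads X J => isBlank (r (Some tV)))
     (Seq (scan_right aux (Some tH)) test_runs)
     (print_bit false)) (c iw v5 (zt aux p' w')) c'
     ((2 * size h).+1 + 30 * (size g + size h + size x + t + n + 1)).+1 &
    if (x \in map fst bs) && (y false == y true)
    then c' = loop_cfg g h (rev (Comma :: bx) ++ u) w
    else prints [:: Bit false] (c' None).2.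
  rewrite /v5; case: (boolP (x \in map fst bs)) => [found|_]; last first.
    have [c' r post] := runs_print_bit false (c iw (zt aux [::] (NodeMark :: bx)) (zt aux p' w')).
    exists c' => //; apply: runs_If.
    by apply: runs_le r; clear; lia.
  have [c' r post] := runs_test_runs iw (out found) size_y.
  exists c' => //; apply: runs_If.
  have r0 : runs (scan_right aux (Some tH))
      (c iw (zt aux (rev (NodeMark :: bx)) [::]) (zt aux p' w'))
      (c iw (zt aux (rev (NodeMark :: bx)) [::]) ht) (2 * size h).+1.
    apply: runs_to (runs_scan_right (u := p') (w := w') _) _ _ => //.
    - by rewrite /c upd_tH /ht -[in RHS]eq_h rev_cat revK.
    - by rewrite -eq_h size_cat; move: (size w') (size _) => a b; clear; lia.
  exact: runs_Seq r0 r.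
exists c' => //.
apply: runs_to (runs_Seq r1 (runs_Seq r2 (runs_Seq r3 (runs_Seq r4 (runs_Seq r5 r6))))) _ _ => //.
rewrite -/h; move: (size g) (size h) (size x) => a b d; clear; lia.
Qed.

Definition check_nodes : prog X J :=
  While (fun r => isSym Comma (r None)) check_node.

Definition enc_nodes (xs : seq bitseq) : seq sym :=
  flatten [seq Comma :: map Bit x | x <- xs].

(** [k], [t] and [n] are uniform in the node, which makes the total time a product. *)
Lemma runs_check_nodes g bs t n k (ok : pred bitseq) xs u (h := flatten (map block bs)) :
  all (block_wf aux) bs ->
  (forall x, x \in xs -> size x <= k /\ exists y : bool -> seq sym,
    [/\ x \in map fst bs -> forall b,
          tm_outputs_within T (map Bit x ++ if b then h else g) (y b) t,
        size (y false) <= n & ok x = (x \in map fst bs) && (y false == y true)]) ->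
  exists2 c', runs check_nodes (loop_cfg g h u (enc_nodes xs)) c'
      (size xs * (60 * (size g + size h + k + t + n + 1)).+1).+1 &
    if all ok xs then exists u', c' = loop_cfg g h u' [::]
    else prints [:: Bit false] (c' None).2.
Proof.
move=> wf; elim: xs u => [|x xs IH] u okP.
  by exists (loop_cfg g h u [::]); [apply: runs_While_exit | exists u].
have [size_x [y [out size_y ok_x]]] := okP x (mem_head _ _).
have bw : ~~ isBit (scat (enc_nodes xs) (@blank X) 0) by case: (xs).
have [c1 r1 post1] := @runs_check_node g bs u x _ y t n wf bw out size_y.
have enter : isSym Comma (read_all (loop_cfg g h u (enc_nodes (x :: xs))) None).
  by rewrite /read_all /= eqxx.
have {}r1 : runs check_node (loop_cfg g h u (enc_nodes (x :: xs))) c1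
    (60 * (size g + size h + k + t + n + 1)).
  apply: runs_le r1; rewrite leq_mul2l /=.
  by move: size_x; rewrite -/h; move: (size g) (size h) (size x) => a b d; clear; lia.
rewrite [all _ _]/= ok_x; case: ifP post1 => [_ c1E|_ bad]; last first.
  exists c1 => //; apply: runs_le (runs_While_loop _ r1 (runs_While_exit _ _)) => //.
    by move: (60 * _) => B; rewrite [size (x :: xs)]/= mulSn; move: (size xs * _) => a; clear; lia.
  by have [/= b0 _] := bad; rewrite /read_all /sread b0; apply/eqP.
rewrite c1E in r1.
have [c2 r2 post2] := IH (rev (Comma :: map Bit x) ++ u)
  (fun z z_xs => okP z (mem_behead (s := x :: xs) z_xs)).
exists c2 => //; apply: runs_le (runs_While_loop _ r1 r2) => //.
by move: (60 * _) => B; rewrite [size (x :: xs)]/= mulSn; move: (size xs * _) => a; clear; lia.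
Qed.

(** A blank under the input head at the end means that the list was exhausted without rejection;
    otherwise the answer [Bit false] is already there. *)
Definition verifier : prog X J :=
  Seq (copy_right (fun o => ~~ isSym Sharp o) None (Some tG))
  (Seq (move_tape aux MoveRight None)
  (Seq (copy_right (fun o => ~~ isSym Sharp o) None (Some tH))
  (Seq (move_tape aux MoveRight None)
  (Seq check_nodes
  (If (fun r => isBlank (r None)) (print_bit true) (Act (fun r => idle r))))))).

Lemma runs_verifier g bs t n k (ok : pred bitseq) xs (h := flatten (map block bs)) :
  Sharp \notin g -> Sharp \notin h -> all (block_wf aux) bs ->
  (forall x, x \in xs -> size x <= k /\ exists y : bool -> seq sym,
    [/\ x \in map fst bs -> forall b,
          tm_outputs_within T (map Bit x ++ if b then h else g) (y b) t,
        size (y false) <= n & ok x = (x \in map fst bs) && (y false == y true)]) ->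
  exists2 c', runs verifier (@init_tapes _ _ _ (g ++ Sharp :: h ++ Sharp :: enc_nodes xs)) c'
      (2 * size g + 2 * size h + size xs * (60 * (size g + size h + k + t + n + 1)).+1 + 10) &
    prints [:: Bit (all ok xs)] (c' None).2.
Proof.
move=> gS hS wf okP; set w2 := enc_nodes xs; set w1 := h ++ Sharp :: w2.
pose c i q1 q2 := cfg i no_tape no_tape q1 q2 (fun=> no_tape) (fun _ _ => no_tape).
have c0E : @init_tapes _ _ _ (g ++ Sharp :: w1)
    = c (zt aux [::] (g ++ Sharp :: w1)) no_tape no_tape.
  apply: functional_extensionality => -[[| | | |b|b l]|] //.
  congr pair; apply: functional_extensionality => j.
  by elim: (_ ++ _) j => [|a w IH] [|j] //=; apply: IH.
have notS w : Sharp \notin w -> all (fun a => ~~ isSym Sharp (Some (inl a : X))) w.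
  by move=> wS; apply/allP => a a_w; rewrite /isSym; apply: contra wS => /eqP <-.
have r1 : runs (copy_right (fun o => ~~ isSym Sharp o) None (Some tG))
    (c (zt aux [::] (g ++ Sharp :: w1)) no_tape no_tape)
    (c (zt aux (rev g) (Sharp :: w1)) (zt aux (rev g) [::]) no_tape) (2 * size g).+1.
  apply: runs_to (runs_copy_right (l := blank) (w := g) (s := scat (Sharp :: w1) blank)
    (x := [::]) _ (notS _ gS) _ _ _) _ _ => //.
  - by rewrite /= eqxx.
  - by rewrite /c /zt scat_cat.
  - by rewrite /c upd_input upd_tG cats0.
have r2 : runs (move_tape aux MoveRight None)
    (c (zt aux (rev g) (Sharp :: w1)) (zt aux (rev g) [::]) no_tape)
    (c (zt aux (Sharp :: rev g) w1) (zt aux (rev g) [::]) no_tape) 1.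
  by apply: runs_to (runs_move_tape _ _ _) _ _ => //; rewrite /c upd_input.
have r3 : runs (copy_right (fun o => ~~ isSym Sharp o) None (Some tH))
    (c (zt aux (Sharp :: rev g) w1) (zt aux (rev g) [::]) no_tape)
    (c (zt aux (rev h ++ Sharp :: rev g) (Sharp :: w2)) (zt aux (rev g) [::]) (zt aux (rev h) [::]))
    (2 * size h).+1.
  apply: runs_to (runs_copy_right (l := scat (Sharp :: rev g) blank) (w := h)
    (s := scat (Sharp :: w2) blank) (x := [::]) _ (notS _ hS) _ _ _) _ _ => //.
  - by rewrite /= eqxx.
  - by rewrite /c /zt scat_cat.
  - by rewrite /c upd_input upd_tH cats0 /zt scat_cat.
have r4 : runs (move_tape aux MoveRight None)
    (c (zt aux (rev h ++ Sharp :: rev g) (Sharp :: w2)) (zt aux (rev g) [::]) (zt aux (rev h) [::]))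
    (loop_cfg g h (Sharp :: rev h ++ Sharp :: rev g) w2) 1.
  by apply: runs_to (runs_move_tape _ _ _) _ _ => //; rewrite /c upd_input.
have [c5 r5 post] := runs_check_nodes (Sharp :: rev h ++ Sharp :: rev g) wf okP.
have [c6 r6 post6] : exists2 c', runs
    (If (fun r => isBlank (r None)) (print_bit true) (Act (fun r => idle r))) c5 c' 4 &
    prints [:: Bit (all ok xs)] (c' None).2.
  case: ifP post => [_ [u' ->]|_ bad].
    have [c' r p] := runs_print_bit true (loop_cfg g h u' [::]).
    by exists c' => //; apply: runs_If.
  exists c5 => //; apply: runs_If; have [/= b0 _] := bad.
  rewrite /read_all /sread b0 /=.
  by apply: runs_to (runs_Act _ _) (act_idle _) _.
exists c6 => //; rewrite c0E.
apply: runs_to (runs_Seq r1 (runs_Seq r2 (runs_Seq r3 (runs_Seq r4 (runs_Seq r5 r6))))) _ _ => //.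
pose s := size xs * (60 * (size g + size h + k + t + n + 1)).+1.
change ((2 * size g).+1 + (1 + ((2 * size h).+1 + (1 + (s.+1 + 4))))
  <= 2 * size g + 2 * size h + s + 10).
by move: s (size g) (size h) => a b d; clear; lia.
Qed.

End Verifier.

(** * Encodings *)

Definition unbits (x : bitseq) : nat := foldr (fun (b : bool) n => b + n.*2) 0 x.

(** This inverse is what makes comparing identifiers or labels letter by letter sound. *)
Lemma bitsK : cancel bits unbits.
Proof.
move=> n; rewrite -[RHS]bin_of_natK /bits; case: bin_of_nat => //= p.
elim: p => [p IH|p IH|] //=; rewrite IH ?natTrecE; lia.
Qed.

Lemma enc_nat_inj : injective enc_nat.
Proof. by apply: inj_comp (can_inj bitsK); apply: inj_map => ? ? []. Qed.

Lemma enc_label_inj (L : finType) : injective (@enc_label L).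
Proof. by move=> l l' /enc_nat_inj/val_inj/enum_rank_inj. Qed.

Lemma all_bits (a : sym) (x : bitseq) : (forall b, Bit b != a) -> a \notin map Bit x.
Proof. by move=> aP; apply/mapP => -[b _ eq_a]; have := aP b; rewrite eq_a eqxx. Qed.

Lemma notin_flatten (T : eqType) (a : T) (ss : seq (seq T)) :
  (forall s, s \in ss -> a \notin s) -> a \notin flatten ss.
Proof. by move=> ssP; apply/flattenP => -[s /ssP/negP]. Qed.

Definition node_block (d : nat) (G : graph d) (v : nodes G) : bitseq * seq sym :=
  (bits (val v), enc_row (feat G v) ++
     flatten [seq EdgeMark :: enc_nat (val u) | u <- node_seq G & adj v u]).

Lemma enc_graph_blocks (d : nat) (G : graph d) :
  enc_graph G = flatten (map block (map (@node_block d G) (node_seq G))).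
Proof. by rewrite -map_comp. Qed.

Section NodeBlock.
Variables (d : nat) (G : graph d) (a : sym).
Hypotheses (aB : forall b, Bit b != a) (aN : a \notin [:: Slash; Comma; EdgeMark]).

Lemma notin_node_block (v : nodes G) : a \notin (node_block v).2.
Proof.
move: aN; rewrite !inE !negb_or => /and3P[aS aC aE].
rewrite mem_cat negb_or; apply/andP; split; apply: notin_flatten => s /mapP[j _ ->].
  rewrite in_cons negb_or aC mem_cat negb_or !in_cons !negb_or eq_sym aB aS.
  by rewrite !all_bits.
by rewrite in_cons negb_or aE all_bits.
Qed.

End NodeBlock.

Lemma Sharp_notin_enc_graph (d : nat) (G : graph d) : Sharp \notin enc_graph G.
Proof.
have SB b : Bit b != Sharp by apply/eqP.
have SN : Sharp \notin [:: Slash; Comma; EdgeMark].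
  by apply/negP; rewrite !inE => /or3P[] /eqP.
rewrite enc_graph_blocks; apply: notin_flatten => s /mapP[_ /mapP[v _ ->] ->].
rewrite in_cons mem_cat !negb_or (all_bits _ SB) (notin_node_block SB SN) !andbT.
by apply/eqP.
Qed.

(** What follows the identifier starts with [Comma] or [EdgeMark], or is empty when [d] is 0 and the
    node is isolated. *)
Lemma node_block_wf (aux : eqType) (d : nat) (G : graph d) :
  all (block_wf aux) (map (@node_block d G) (node_seq G)).
Proof.
have NB b : Bit b != NodeMark by apply/eqP.
have NN : NodeMark \notin [:: Slash; Comma; EdgeMark].
  by apply/negP; rewrite !inE => /or3P[] /eqP.
apply/allP => _ /mapP[v _ ->]; rewrite /block_wf (notin_node_block NB NN) /=.
rewrite /enc_row; case: (enum _) => //=.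
by case: (filter _ _).
Qed.

Lemma mem_node_blocks (d : nat) (G : graph d) (n : nat) :
  (bits n \in map fst (map (@node_block d G) (node_seq G))) = (n \in nodes G).
Proof.
rewrite -map_comp; apply/mapP/idP => [[v _ /= /(can_inj bitsK) ->]|nG]; first exact: valP.
by exists [` nG]%fset; rewrite // mem_sort mem_enum.
Qed.

Lemma tm_outputs_within_le (S : finType) (T : machine S) x y t t' : t <= t' ->
  tm_outputs_within T x y t -> tm_outputs_within T x y t'.
Proof.
move=> le_t [ht out]; rewrite /tm_outputs_within -(subnK le_t) iterD.
by rewrite iter_fix // /tm_step ht.
Qed.

(** Coefficients in [nat] cannot be negative. This allows one time bound, taken at the size of the
    instance, for all simulated runs. *)
Lemma horner_nat_le (p : {poly nat}) (m n : nat) : m <= n -> p.[m]%R <= p.[n]%R.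
Proof.
move=> le_mn; rewrite !horner_coef; apply: leq_sum => i _.
rewrite leq_mul2l !natrE; apply/orP; right.
by case: (nat_of_ord i) => // k; rewrite leq_exp2r.
Qed.

Lemma prints_nth (aux : Type) y (s : nat -> option (sym + aux)%type) : prints y s ->
  forall i, i <= size y -> s i = nth None (map (Some \o inl) y) i.
Proof.
elim: y s => [|a y IH] s /=; first by move=> s0 [|i].
by case=> s0 ps [|i] //= le_i; rewrite -(IH _ ps).
Qed.

Lemma size_flatten_cons (S A : Type) (a : S) (f : A -> seq S) (xs : seq A) :
  size xs <= size (flatten [seq a :: f x | x <- xs]).
Proof. by elim: xs => //= x xs IH; rewrite size_cat; apply: leq_trans IH (leq_addl _ _). Qed.

(** * Witnesses in terms of labels, and the final time bound *)

Section Witness.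
Local Open Scope fset_scope.
Variables (d : nat) (L : finType) (M : classifier d L).
Implicit Types (C : witness_instance d).

(** One identifier names nodes of different types in the graph and in the subgraph; a partial
    function on identifiers lets their labels be compared. *)
Definition node_label (G : graph d) (n : nat) : option L :=
  omap (@M G) (insub n : option (nodes G)).

Definition same_label C (n : nat) : bool :=
  (n \in nodes (wi_sub C)) && (node_label (wi_graph C) n == node_label (wi_sub C) n).

Definition test_seq C : seq nat := sort leq (enum_fset (wi_test C)).

Lemma mem_test_seq C n : (n \in test_seq C) = (n \in wi_test C).
Proof. by rewrite mem_sort. Qed.

Lemma node_label_val (G : graph d) (v : nodes G) : node_label G (val v) = Some (@M G v).
Proof. by rewrite /node_label valK. Qed.

Lemma is_witnessP C : all (same_label C) (test_seq C) <-> is_witness M C.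
Proof.
split=> [/allP wit v v_test|wit].
  have := wit (val v); rewrite mem_test_seq => /(_ v_test)/andP[v_sub].
  have -> : val v = val [` v_sub] by [].
  rewrite node_label_val -[val [` v_sub]]/(val v) node_label_val => /eqP[eq_l].
  by split=> //; [exact: wi_subgraph | exists [` v_sub]].
apply/allP => n; rewrite mem_test_seq => n_test.
have nG : n \in nodes (wi_graph C) by apply: (fsubsetP (wi_test_nodes C)).
have [_ _ [w [val_w eq_l]]] := wit [` nG] n_test.
rewrite /= in val_w; apply/andP; split; first by rewrite -val_w; apply: fsvalP.
apply/eqP; rewrite [LHS](node_label_val [` nG]) -eq_l.
by rewrite -[in RHS]val_w; apply/esym/node_label_val.
Qed.

End Witness.

Theorem lemma2 (d : nat) (L : finType) (M : classifier d L)
    (hM : poly_time_classifier M) :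
  in_PTIME (@enc_instance d) (is_witness M).
Proof.
case: hM => T [p hT].
exists (fun C => all (same_label M C) (test_seq C)); split; first exact: is_witnessP.
(* A constant, since [L] is finite and fixed. *)
pose n := \max_(l : L) size (enc_label l).
exists (compile (verifier T)).
(* Splitting the input costs at most [4 X]. There are at most [X] rounds; in each, [3 X] bounds the
   two graphs and the node, [p] the simulated runs, and [n] the label. *)
exists (4%N%:P * 'X + 'X * (60%N%:P * (3%N%:P * 'X + p + (n + 1)%N%:P) + 1%N%:P) + 10%N%:P)%R => C.
set s := size (enc_instance C).
pose bs := map (@node_block d (wi_sub C)) (node_seq (wi_sub C)).
have bsE : flatten (map block bs) = enc_graph (wi_sub C) by rewrite enc_graph_blocks.
have encE : enc_instance C = enc_graph (wi_graph C) ++ Sharp :: flatten (map block bs) ++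
    Sharp :: enc_nodes (map bits (test_seq C)).
  by rewrite bsE /enc_instance /enc_nodes -map_comp.
have sizeE : s = size (enc_graph (wi_graph C)) + size (flatten (map block bs)) +
    size (enc_nodes (map bits (test_seq C))) + 2.
  by rewrite /s encE !size_cat /= size_cat /=; clear; lia.
pose ok x := same_label M C (unbits x).
have [||||c r out] := @runs_verifier T (enc_graph (wi_graph C)) bs p.[s]%R n s ok
  (map bits (test_seq C)).
- exact: Sharp_notin_enc_graph.
- by rewrite bsE Sharp_notin_enc_graph.
- exact: node_block_wf.
- move=> _ /mapP[m m_test ->].
  have mG : m \in nodes (wi_graph C).
    by apply: (fsubsetP (wi_test_nodes C)); rewrite -mem_test_seq.
  have size_m : size (bits m) <= size (enc_nodes (map bits (test_seq C))).
    elim: (test_seq C) m_test => //= k ks IH; rewrite inE => /predU1P[->|/IH le_m].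
      by rewrite /enc_nodes /= size_cat size_map; clear; lia.
    by rewrite /enc_nodes /= size_cat; apply/leqW/(leq_trans le_m); apply: leq_addl.
  split; first by rewrite sizeE; move: size_m; clear; lia.
  pose graph_of b := if b then wi_sub C else wi_graph C.
  (* [[::]] is a placeholder for a node missing from the subgraph, where [ok] is false anyway. *)
  pose y b := if node_label M (graph_of b) m is Some l then enc_label l else [::].
  have yE b (mb : m \in nodes (graph_of b)) : y b = enc_label (M _ [` mb]%fset).
    by rewrite /y (node_label_val M [` mb]%fset).
  exists y; split.
  + rewrite mem_node_blocks => mH b.
    have mb : m \in nodes (graph_of b) by rewrite /graph_of; case: (b).
    have := hT (existT _ _ [` mb]%fset); rewrite -yE /enc_pointed /=.
    have -> : (if b then flatten (map block bs) else enc_graph (wi_graph C))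
        = enc_graph (graph_of b) by rewrite bsE; case: (b).
    apply: tm_outputs_within_le; apply: horner_nat_le.
    (* The graph and the identifier occur disjointly in the instance, beside two [Sharp]s. *)
    have size_b : size (enc_graph (graph_of b)) + size (bits m) + 2 <= s.
      rewrite sizeE bsE; move: size_m; rewrite /graph_of.
      by case: (b); clear; lia.
    by rewrite size_cat size_map; move: size_b; clear; lia.
  + by rewrite (yE false mG) /n; apply: (leq_bigmax (F := fun l => size (enc_label l))).
  + rewrite /ok bitsK /same_label mem_node_blocks; case: (boolP (m \in _)) => //= mH.
    rewrite (yE false mG) (yE true mH) (inj_eq (@enc_label_inj L)).
    by rewrite (node_label_val M [` mG]%fset) (node_label_val M [` mH]%fset).
rewrite -encE in r.
have all_ok : all ok (map bits (test_seq C)) = all (same_label M C) (test_seq C).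
  by rewrite all_map; apply: eq_all => m; rewrite /= /ok bitsK.
rewrite all_ok in out.
apply: compile_outputs (runs_le _ r) (prints_nth out).
rewrite !hornerD !hornerM !hornerD !hornerM !hornerD !hornerM !hornerC !hornerX !natrE.
have size_xs : size (map bits (test_seq C)) <= s.
  apply: leq_trans (size_flatten_cons Comma (map Bit) _) _.
  by rewrite sizeE -/(enc_nodes _); clear; lia.
rewrite -addnA -[X in _ <= X]addnA; apply: leq_add.
  rewrite sizeE; move: (size (flatten _)) (size (enc_nodes _)) (size (enc_graph _)) => a b e.
  by clear; lia.
rewrite leq_add2r; apply: leq_mul => //.
have le_sum (a b e q m : nat) : a + b <= 2 * e ->
    (60 * (a + b + e + q + m + 1)).+1 <= 60 * (3 * e + q + (m + 1)) + 1 by clear; lia.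
apply: le_sum; rewrite sizeE.
move: (size (flatten _)) (size (enc_nodes _)) (size (enc_graph _)) => a b e.
by clear; lia.
Qed.
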